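(* Let $\mathcal{F}$ be the set of (isomorphism classes of) graphs $H$ with $6 \le |V(H)| \le 8$ such that $H$ is not in $1$-$HNG$ but every proper induced subgraph of $H$ is in $1$-$HNG$. A graph $G$ is in $1$-$HNG$ if and only if $G$ contains no element of $\mathcal{F}$ as an induced subgraph.
   Context: All graphs are finite, simple, and have at least one vertex; induced subgraphs are taken on nonempty vertex sets. $\chi(G)$ is the chromatic number and $\theta(G)=\chi(\overline{G})$ is the clique cover number (the least number of cliques into which $V(G)$ can be partitioned). A graph $G$ is in the class $1$-$HNG$ if every induced subgraph $H$ of $G$ (including $G$ itself) satisfies $\chi(H)+\theta(H)\ge |V(H)|$. (For reference, $\mathcal{F}$ is recorded as consisting of 52 graphs: 24 on 6 vertices, namely the 12 bipartite graphs on 6 vertices having a perfect matching and their 12 complements; 24 on 7 vertices; and 4 on 8 vertices.) *)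

(* Defs.v *)
From mathcomp Require Import all_boot.

Set Implicit Arguments.
Unset Strict Implicit.
Unset Printing Implicit Defensive.

(* The null graph is not excluded here; the requirement that graphs have a
   vertex appears as a hypothesis where it is needed. *)
Record sgraph := SGraph {
  vertex :> finType;
  adj : rel vertex;
  adj_sym : symmetric adj;
  adj_irrefl : irreflexive adj
}.

Section Complement.
Variable G : sgraph.

Definition compl_adj : rel G := fun x y => (x != y) && ~~ adj x y.

Lemma compl_adj_sym : symmetric compl_adj.
Proof. by move=> x y; rewrite /compl_adj eq_sym adj_sym. Qed.

Lemma compl_adj_irrefl : irreflexive compl_adj.
Proof. by move=> x; rewrite /compl_adj eqxx. Qed.

Definition compl : sgraph := SGraph compl_adj_sym compl_adj_irrefl.

End Complement.

Section Induced.
Variables (G : sgraph) (S : {set G}).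

Definition induced_adj : rel {x : G | x \in S} := fun x y => adj (val x) (val y).

Lemma induced_adj_sym : symmetric induced_adj.
Proof. by move=> x y; rewrite /induced_adj adj_sym. Qed.

Lemma induced_adj_irrefl : irreflexive induced_adj.
Proof. by move=> x; rewrite /induced_adj adj_irrefl. Qed.

Definition induced : sgraph := SGraph induced_adj_sym induced_adj_irrefl.

End Induced.

Definition graph_iso (G H : sgraph) : Prop :=
  exists2 f : G -> H, bijective f & forall x y, adj (f x) (f y) = adj x y.

Definition contains_induced (G H : sgraph) : Prop :=
  exists2 S : {set G}, S != set0 & graph_iso (induced S) H.

Definition colorable (G : sgraph) (k : nat) : bool :=
  [exists c : {ffun G -> 'I_k}, [forall x, forall y, adj x y ==> (c x != c y)]].

Lemma colorable_card (G : sgraph) : exists k, colorable G k.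
Proof.
exists #|G|; apply/existsP; exists [ffun x => enum_rank x].
apply/forallP => x; apply/forallP => y; apply/implyP => xy.
rewrite !ffunE (inj_eq enum_rank_inj).
by apply: contraTneq xy => ->; rewrite adj_irrefl.
Qed.

Definition chi (G : sgraph) : nat := ex_minn (colorable_card G).

Definition theta (G : sgraph) : nat := chi (compl G).

Definition one_HNG (G : sgraph) : Prop :=
  forall S : {set G}, S != set0 ->
    #|induced S| <= chi (induced S) + theta (induced S).

(* An isomorphism-invariant predicate, standing for the set of isomorphism
   classes. *)
Definition in_F (H : sgraph) : Prop :=
  [/\ 6 <= #|H| <= 8,
      ~ one_HNG H
    & forall S : {set H}, S != set0 -> S \proper [set: H] ->
        one_HNG (induced S)].

(* Main.v *)
Require Import Defs.
From mathcomp Require Import all_boot.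
From mathcomp Require Import zify.

(* On a vertex set S, [chi + theta < |S|] holds iff S has a partition into
   cliques and a partition into stable sets with fewer than |S| classes
   altogether; call S bad.  A clique and a stable set share at most one vertex,
   so S is the edge set of a simple bipartite graph B whose nodes are the
   classes, and this alone forces |S| >= 6.

   Let S be a bad set of least size and suppose |S| >= 9.  Then there are
   exactly |S| - 1 classes, all of them have at least two members, and the
   numbers (size - 2) sum to 2.  Moreover a set W of vertices can never be
   traded for a proper subset W' such that |W| - |W'| is at most the number of
   classes saved.  This rules out eight fragments of B: for each of them every
   choice of the undetermined adjacencies allows a trade or exhibits a bad set
   of at most 8 vertices.  Exploring B from a class with three members, one
   always runs into one of the eight fragments, or into a component with at
   most 8 vertices.  Both case analyses are scripts run by a verified
   checker. *)

Set Implicit Arguments.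
Unset Strict Implicit.
Unset Printing Implicit Defensive.

(** * Bad sets of minimum size *)

(** The numbers (size - 2) are nonnegative with sum 2, so B has minimum degree 2 and one more edge
    than nodes. Hence a node of degree at least 3 lies in a component made of two cycles sharing a
    node, two cycles joined by a path, or three paths with common ends. Such a component is
    described by a few path lengths. The fragment [chain] bounds them, which makes the growth of the
    component a finite search although |S| is not bounded in advance. The obstacle is that B fixes
    adjacency only inside classes; a pair of vertices without a common class is unconstrained.
    Refuting a fragment therefore means branching on such pairs until some deletion of vertices is
    paid for by classes saved, whereas growing B needs no adjacency outside the classes. Keeping the
    two tasks apart, each fragment is settled once and then applied wherever it or its mirror image
    under complementation turns up. The bound 9 serves only to exclude the small bad sets met on the
    way. *)

Section Covers.
Variable V : finType.
Implicit Types (e : rel V) (t : bool) (S A B : {set V}).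

(* The boolean t stands for cliques when true, for stable sets when false. *)
Definition homog (T : eqType) e t S (f : V -> T) :=
  {in S &, forall x y, f x = f y -> x != y -> e x y = t}.

(** The colour type is arbitrary and only the colours met on [S] are counted, so covers can be
    united, restricted and composed without renumbering. *)
Definition coverable e t S k :=
  exists (T : finType) (f : V -> T), homog e t S f /\ #|f @: S| <= k.

Definition bad e S :=
  exists k : bool -> nat,
    (forall t, coverable e t S (k t)) /\ k true + k false < #|S|.

Lemma coverable_sub e t A B k l :
  A \subset B -> k <= l -> coverable e t B k -> coverable e t A l.
Proof.
move=> sAB kl [T [f [fh fk]]]; exists T, f; split.
  by move=> x y /(subsetP sAB) xB /(subsetP sAB) yB; apply: fh.
exact: leq_trans (leq_trans (subset_leq_card (imsetS _ sAB)) fk) kl.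
Qed.

Lemma coverableU e t A B k l :
  coverable e t A k -> coverable e t B l -> coverable e t (A :|: B) (k + l).
Proof.
move=> [T [f [fh fk]]] [U [g [gh gl]]].
exists (T + U)%type, (fun x => if x \in A then inl (f x) else inr (g x)).
split.
  move=> x y; rewrite !inE; case: ifP => xA; case: ifP => yA //= xB yB [].
    exact: fh.
  exact: gh.
apply: leq_trans (leq_add fk gl).
rewrite -(card_imset (f @: A) (@inl_inj T U)) -(card_imset (g @: B) (@inr_inj T U)).
apply: leq_trans (leq_card_setU _ _); apply/subset_leq_card/subsetP => z /imsetP[x].
rewrite !inE => xAB ->; case: ifP xAB => xA /= xB.
  by rewrite imset_f ?imset_f.
by rewrite [X in _ || X]imset_f ?orbT ?imset_f.
Qed.

Lemma coverable0 e t : coverable e t set0 0.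
Proof.
exists unit, (fun=> tt); split; last by rewrite imset0 cards0.
by move=> x y; rewrite inE.
Qed.

Lemma coverable1 e t A :
  {in A &, forall x y, x != y -> e x y = t} -> coverable e t A 1.
Proof.
move=> Ah; exists unit, (fun=> tt); split; first by move=> x y xA yA _; apply: Ah.
by rewrite -card_unit max_card.
Qed.

Lemma coverable_seq e t (qs : seq {set V}) :
  (forall q, q \in qs -> {in q &, forall x y, x != y -> e x y = t}) ->
  coverable e t (\bigcup_(q <- qs) q) (size qs).
Proof.
elim: qs => [|q qs IH] qh; first by rewrite big_nil; apply: coverable0.
rewrite big_cons; apply: (@coverableU _ _ _ _ 1).
  by apply/coverable1/qh; rewrite mem_head.
by apply: IH => r rqs; apply: qh; rewrite inE rqs orbT.
Qed.

End Covers.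

(** * Minimum bad sets with a fixed pair of partitions *)

Section Critical.
Variables (V T : finType).
Implicit Types (e : rel V) (t : bool) (S W : {set V}) (L : bool -> V -> T).

Definition fiber S L t z := [set x in S | L t x == z].

Record critical e S L : Prop := Critical {
  crit_sym : symmetric e;
  crit_homog : forall t, homog e t S (L t);
  crit_card : #|L true @: S| + #|L false @: S| + 1 = #|S|;
  crit_ge9 : 9 <= #|S|;
  crit_min : forall R, bad e R -> #|S| <= #|R|
}.

(** Complementation exchanges cliques and stable sets. As [homog] compares distinct vertices only,
    negating [e] on the diagonal as well does no harm. *)
Lemma critical_swap e S L sw :
  critical e S L ->
  critical (fun x y => e x y (+) sw) S (fun t => L (t (+) sw)).
Proof.
case=> es eh ec e9 em; split=> //.
- by move=> x y; rewrite es.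
- by move=> t x y xS yS fxy xy; rewrite (eh _ _ _ xS yS fxy xy) -addbA addbb addbF.
- by case: sw => //=; rewrite [#|_| + #|L true @: S|]addnC.
move=> R [k [kc ks]]; apply: em; exists (fun t => k (t (+) sw)); split.
  move=> t; have [U [f [fh fk]]] := kc (t (+) sw).
  exists U, f; split=> // x y xR yR fxy xy; apply: (@addIb sw).
  exact: fh fxy xy.
by case: sw {kc} => //=; rewrite addnC.
Qed.

(* The classes with labels in F lie inside W and are destroyed; the members
   of W' that belonged to them are redistributed into k true + k false new
   classes. *)
Lemma critical_no_trade e S L W W' (F : bool -> {set T}) (k : bool -> nat) :
  critical e S L -> W \subset S -> W' \subset W ->
  (forall t x, x \in S -> L t x \in F t -> x \in W) ->
  (forall t, F t \subset L t @: S) ->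
  (forall t, coverable e t [set x in W' | L t x \in F t] (k t)) ->
  #|W'| < #|W| -> k true + k false + #|W| <= #|W'| + #|F true| + #|F false| ->
  False.
Proof.
move=> [es eh ec e9 em] WS W'W FW FS kc W'lt kle.
have cR : #|(S :\: W) :|: W'| = #|S| - #|W| + #|W'|.
  rewrite cardsU cardsD (setIidPr WS).
  rewrite (_ : _ :&: _ = set0) ?cards0 ?subn0 //.
  apply/setP => x; rewrite !inE.
  by case: (boolP (x \in W')) => [/(subsetP W'W)->|]; rewrite ?andbF.
have cWS := subset_leq_card WS.
suff /em : bad e ((S :\: W) :|: W') by rewrite cR; lia.
(* As S has |S| - 1 classes, the new total lies below the new size exactly when the classes saved
   make up for the vertices lost. *)
exists (fun t => (#|L t @: S| - #|F t|) + k t); split; last first.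
  have := subset_leq_card (FS true); have := subset_leq_card (FS false).
  rewrite cR; lia.
move=> t; have cA : coverable e t [set x in S | L t x \notin F t] (#|L t @: S| - #|F t|).
  exists T, (L t); split.
    by move=> x y; rewrite !inE => /andP[xS _] /andP[yS _]; apply: eh.
  rewrite -(setIidPr (FS t)) -cardsD; apply/subset_leq_card/subsetP => z /imsetP[x].
  rewrite inE => /andP[xS]; rewrite in_setI imset_f //= => xF ->.
  by rewrite in_setD xF imset_f.
apply: coverable_sub (leqnn _) (coverableU cA (kc t)).
(* A vertex outside [W] keeps its class, because destroyed classes lie inside [W]. *)
apply/subsetP => x; rewrite !inE => /orP[/andP[xW xS]|xW'].
  rewrite xS /=; case: (boolP (L t x \in F t)) => // /(FW _ _ xS) xW2.
  by rewrite xW2 in xW.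
by rewrite xW' (subsetP WS) ?(subsetP W'W) //= orNb.
Qed.

(** Deleting the only member of a class loses one vertex and saves one class, an admissible trade
    with [W'] empty. *)
Lemma critical_class_gt1 e S L t x :
  critical e S L -> x \in S -> exists y, [/\ y \in S, y != x & L t y = L t x].
Proof.
move=> crit xS.
case: (pickP [pred y in S | (y != x) && (L t y == L t x)]) => [y|noy].
  by case/and3P => yS yx /eqP Lyx; exists y.
exfalso; apply: (@critical_no_trade e S L [set x] set0
  (fun u => if u == t then [set L t x] else set0) (fun=> 0)) => //.
- by rewrite sub1set.
- exact: sub0set.
- move=> u y yS; case: eqP => [->|_]; rewrite !inE // => Ly.
  by apply: contraFT (noy y) => yx; rewrite /= yS yx.
- by move=> u; case: eqP => [->|_]; rewrite ?sub0set // sub1set imset_f.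
- move=> u; rewrite (_ : [set _ in _ | _] = set0); first exact: coverable0.
  by apply/setP => y; rewrite !inE.
- by rewrite cards0 cards1.
by rewrite cards1 cards0; case: t {noy} => /=; rewrite cards1 ?cards0.
Qed.

(** The classes of each type partition S, so all sizes add up to 2|S|, while twice the number of
    classes is 2|S| - 2. The truncated subtraction is exact because no class is a singleton. *)
Lemma critical_surplus e S L :
  critical e S L ->
  \sum_(z in L true @: S) (#|fiber S L true z| - 2) +
  \sum_(z in L false @: S) (#|fiber S L false z| - 2) = 2.
Proof.
move=> crit.
have sum_t t : \sum_(z in L t @: S) (#|fiber S L t z| - 2) + 2 * #|L t @: S| = #|S|.
  rewrite -sum1_card big_distrr /= -big_split /=.
  rewrite -[RHS]sum1_card (partition_big_imset (L t)) /=.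
  apply: eq_bigr => _ /imsetP[x xS ->]; rewrite sum1dep_card subnK //.
  have [y [yS yx Lyx]] := critical_class_gt1 t crit xS.
  have -> : 2 = #|[set x; y]| by rewrite cards2 eq_sym yx.
  apply/subset_leq_card/subsetP => w; rewrite !inE.
  by case/orP => /eqP->; rewrite ?xS ?yS ?Lyx eqxx.
have := sum_t true; have := sum_t false; have := crit_card crit.
rewrite !mul2n -!addnn.
set a := \sum_(_ in _) _; set b := \sum_(_ in _) _; lia.
Qed.

Lemma critical_heavy e S L :
  critical e S L -> exists t x y z,
    [/\ [/\ x \in S, y \in S & z \in S], [/\ x != y, y != z & z != x]
      & L t y = L t x /\ L t z = L t x].
Proof.
move=> crit; have surplus := critical_surplus crit.
have [t [w ht]] : exists t w, 2 < #|fiber S L t w|.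
  case: (pickP [pred w | 2 < #|fiber S L true w|]) => [w ht|h1].
    by exists true, w.
  case: (pickP [pred w | 2 < #|fiber S L false w|]) => [w ht|h2].
    by exists false, w.
  move: surplus; rewrite !big1 // => w _; apply/eqP; rewrite subn_eq0 leqNgt.
    by rewrite [X in ~~ X]h2.
  by rewrite [X in ~~ X]h1.
have /card_gt2P[x [y [z [[xf yf zf] d]]]] := ht.
exists t, x, y, z; move: xf yf zf; rewrite !inE.
by move=> /andP[-> /eqP->] /andP[-> /eqP->] /andP[-> /eqP->].
Qed.

End Critical.

(** * Partial knowledge about a minimum bad set *)

(* The vertices 0, ..., nverts - 1 of a state are distinct; [label t i] names
   the class of type t of the vertex i, [filled t] lists the classes all of
   whose members are among these vertices, and [facts] holds the adjacencies
   fixed by case distinctions. *)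
Record state := State {
  nverts : nat;
  label : bool -> nat -> nat;
  filled : bool -> seq nat;
  facts : seq (nat * nat * bool)
}.

Definition labels s t := [seq label s t i | i <- iota 0 (nverts s)].

Lemma index_lt s t c : c \in labels s t -> index c (labels s t) < nverts s.
Proof. by rewrite -index_mem size_map size_iota. Qed.

Lemma label_index s t c :
  c \in labels s t -> label s t (index c (labels s t)) = c.
Proof.
move=> cs; have lt_c := index_lt cs.
by rewrite -[RHS](nth_index 0 cs) (nth_map 0) ?size_iota // nth_iota.
Qed.

Record realizes (V T : finType) (e : rel V) (S : {set V}) (L : bool -> V -> T)
    (s : state) (v : nat -> V) : Prop := Realizes {
  real_in : forall i, i < nverts s -> v i \in S;
  real_inj : forall i j, i < nverts s -> j < nverts s -> v i = v j -> i = j;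
  real_label : forall t i j, i < nverts s -> j < nverts s ->
    label s t i = label s t j -> L t (v i) = L t (v j);
  real_filled : forall t i x, i < nverts s -> label s t i \in filled s t ->
    x \in S -> L t x = L t (v i) ->
    exists j, [/\ j < nverts s, label s t j = label s t i & x = v j];
  real_facts : forall i j b, (i, j, b) \in facts s -> e (v i) (v j) = b
}.

(* The labels of classes that are not filled may name the same class unless
   the state separates; the fragments are refuted without this assumption and
   therefore also apply where their loose ends meet. *)
Definition separates (V T : finType) (L : bool -> V -> T) s (v : nat -> V) :=
  forall t i j, i < nverts s -> j < nverts s ->
    L t (v i) = L t (v j) -> label s t i = label s t j.

(** Quantifying over [e], [L] and [v] lets a refuted state be applied again to the complement and at
    other vertices. *)
Definition refuted (sep : bool) s :=
  forall (V T : finType) (e : rel V) S (L : bool -> V -> T) v,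
    critical e S L -> realizes e S L s v -> (sep -> separates L s v) -> False.

Definition known s t i j :=
  [|| (i != j) && (label s t i == label s t j),
      (i, j, t) \in facts s | (j, i, t) \in facts s].

Definition is_class s t q :=
  all (fun i => (i < nverts s) && all (fun j => (i == j) || known s t i j) q) q.

Definition open_outside s t (qs : seq (seq nat)) w :=
  all (fun i => (i \in flatten qs) || (label s t i \notin filled s t)) w.

Definition sel T (a b : T) (t : bool) := if t then a else b.

(** An instance of [critical_no_trade]: [W] consists of all vertices of the state, [W'] is [w], the
    filled classes are destroyed, and the last conjunct is the numerical hypothesis. *)
Definition trade_ok s w qs ns :=
  [&& uniq w, all (fun i => i < nverts s) w, size w < nverts s,
      all (fun t => [&& all (is_class s t) (sel qs ns t),
                        open_outside s t (sel qs ns t) w,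
                        uniq (filled s t)
                      & all (fun c => c \in labels s t) (filled s t)])
          [:: true; false]
    & size qs + size ns + nverts s <=
        size w + size (filled s true) + size (filled s false)].

(* A bad set of at most 8 vertices contradicts minimality since |S| >= 9. *)
Definition bad_ok s w qs ns :=
  [&& uniq w, all (fun i => i < nverts s) w,
      all (fun t => all (is_class s t) (sel qs ns t) &&
                    all (fun i => i \in flatten (sel qs ns t)) w)
          [:: true; false]
    & size qs + size ns < size w <= 8].

Definition add_fact s i j b :=
  State (nverts s) (label s) (filled s) ((i, j, b) :: facts s).

Definition members s t c := [seq i <- iota 0 (nverts s) | label s t i == c].

Definition fill s t c :=
  State (nverts s) (label s)
    (fun u => if u == t then c :: filled s u else filled s u) (facts s).

(* The new vertex [nverts s] joins the class c of type t and the class d of the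
   other type. *)
Definition extend s t c d :=
  State (nverts s).+1
    (fun u i => if i == nverts s then (if u == t then c else d) else label s u i)
    (filled s) (facts s).

(** Only members seen so far count, so this is a lower bound for the true sum; a label with fewer
    than two of them contributes 0 by truncation. *)
Definition surplus s t :=
  sumn [seq count_mem c (labels s t) - 2 | c <- undup (labels s t)].

(** The head is a fresh label, as [Grow] checks that all labels in use are below [nverts s]. Classes
    already meeting c are left out since a clique and a stable set share at most one vertex. *)
Definition other_labels s t c :=
  nverts s :: [seq d <- undup (labels s (~~ t))
             | (d \notin filled s (~~ t)) &&
               all (fun i => label s (~~ t) i != d) (members s t c)].

(* Singleton classes cannot be filled, and the numbers (size - 2) add up to 2
   over all classes. *)
Definition children s t c :=
  (if 1 < size (members s t c) then [:: fill s t c] else [::]) ++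
  [seq s' <- [seq extend s t c d | d <- other_labels s t c]
  | surplus s' true + surplus s' false <= 2].

(* [sw] exchanges the roles of cliques and stable sets. *)
Definition embeds k s sw (phi : nat -> nat) :=
  [&& nilp (facts k), all (fun i => phi i < nverts s) (iota 0 (nverts k)),
      uniq [seq phi i | i <- iota 0 (nverts k)]
    & all (fun t => all (fun i =>
        all (fun j => (label k t i == label k t j) ==>
               (label s (t (+) sw) (phi i) == label s (t (+) sw) (phi j)))
            (iota 0 (nverts k)) &&
        ((label k t i \in filled k t) ==>
           (label s (t (+) sw) (phi i) \in filled s (t (+) sw)) &&
           all (fun j => (label s (t (+) sw) j == label s (t (+) sw) (phi i)) ==>
                  has (fun l => (label k t l == label k t i) && (phi l == j))
                      (iota 0 (nverts k)))
               (iota 0 (nverts s))))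
        (iota 0 (nverts k))) [:: true; false]].

(* [Split i j] distinguishes whether i and j are adjacent, and [Grow t c]
   whether the class c is filled or has a further member; [Trade] and [Bad]
   give the retained vertices with the new cliques and the new stable sets (in
   [Trade], a retained vertex outside of them keeps its class, which must not
   be filled), and [Use n sw phi] maps the n-th refuted state into the current
   one. *)
Inductive instr :=
  | Split of nat & nat
  | Grow of bool & nat
  | Trade of seq nat & seq (seq nat) & seq (seq nat)
  | Bad of seq nat & seq (seq nat) & seq (seq nat)
  | Use of nat & bool & seq nat.

Section Run.
Variables (sep : bool) (lib : seq state).

(** [ss] is the stack of states still to be refuted; an instruction replaces or discards its top,
    and script and stack must end together. [Grow] demands [sep] because its surplus test and its
    list of labels take different labels for different classes. *)
Fixpoint run (p : seq instr) (ss : seq state) : bool :=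
  match p, ss with
  | [::], [::] => true
  | Split i j :: p', s :: ss' =>
      [&& i < nverts s, j < nverts s
        & run p' [:: add_fact s i j true, add_fact s i j false & ss']]
  | Grow t c :: p', s :: ss' =>
      [&& sep, c \in labels s t,
          all (fun u => all (fun d => d < nverts s) (labels s u ++ filled s u))
              [:: true; false],
          nilp (facts s)
        & run p' (children s t c ++ ss')]
  | Trade w qs ns :: p', s :: ss' => trade_ok s w qs ns && run p' ss'
  | Bad w qs ns :: p', s :: ss' => bad_ok s w qs ns && run p' ss'
  | Use n sw phi :: p', s :: ss' =>
      [&& n < size lib, embeds (nth s lib n) s sw (nth 0 phi) & run p' ss']
  | _, _ => false
  end.

End Run.

(** * Soundness of the individual checks *)

Section Realized.
Variables (V T : finType) (e : rel V) (S : {set V}) (L : bool -> V -> T).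
Variables (s : state) (v : nat -> V).
Hypotheses (crit : critical e S L) (rv : realizes e S L s v).

Lemma known_adj t i j :
  i < nverts s -> j < nverts s -> known s t i j -> e (v i) (v j) = t.
Proof.
move=> im jm /or3P[/andP[ij /eqP lij]|/(real_facts rv)//|].
  apply: (crit_homog crit); rewrite ?(real_in rv) //.
    exact: real_label rv _ _ _ im jm lij.
  by apply: contraNneq ij => /(real_inj rv im jm) ->.
by rewrite (crit_sym crit) => /(real_facts rv).
Qed.

Definition block (q : seq nat) : {set V} := [set x in [seq v i | i <- q]].

Lemma is_class_block t q :
  is_class s t q -> {in block q &, forall x y, x != y -> e x y = t}.
Proof.
move=> /allP qc _ _ /[!inE] /mapP[i iq ->] /mapP[j jq ->] nij.
have /andP[im /allP/(_ _ jq)/orP[/eqP ij|k]] := qc _ iq.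
  by rewrite ij eqxx in nij.
have /andP[jm _] := qc _ jq; exact: known_adj im jm k.
Qed.

Lemma coverable_blocks t qs (A : {set V}) :
  all (is_class s t) qs ->
  (forall x, x \in A -> exists2 i, i \in flatten qs & x = v i) ->
  coverable e t A (size qs).
Proof.
move=> /allP qc Aq; rewrite -(size_map block).
apply: coverable_sub (leqnn _) (coverable_seq _); last first.
  by move=> _ /mapP[q /qc /is_class_block qh ->].
apply/subsetP => x /Aq[i /flattenP[q qqs iq] ->].
rewrite (big_rem (block q)) ?map_f //= inE; apply/orP; left.
by rewrite inE map_f.
Qed.

Lemma uniq_real w :
  uniq w -> all (fun i => i < nverts s) w -> uniq [seq v i | i <- w].
Proof.
move=> uw /allP wm; rewrite map_inj_in_uniq // => i j /wm im /wm jm.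
exact: real_inj rv _ _ im jm.
Qed.

Lemma card_block w :
  uniq w -> all (fun i => i < nverts s) w -> #|block w| = size w.
Proof.
by move=> uw wm; rewrite cardsE (card_uniqP (uniq_real uw wm)) size_map.
Qed.

Lemma bad_ok_false w qs ns : bad_ok s w qs ns -> False.
Proof.
case/and4P => uw wm /and3P[/andP[cq wq] /andP[cn wn] _] /andP[lt_w w8].
have bw : bad e (block w).
  exists (fun t => size (sel qs ns t)); split; last by rewrite card_block.
  have cov t q : all (is_class s t) q -> all (fun i => i \in flatten q) w ->
      coverable e t (block w) (size q).
    move=> qc /allP wq'; apply: coverable_blocks => // x.
    by rewrite inE => /mapP[i /wq' iq ->]; exists i.
  by case; apply: cov.
have := leq_trans (crit_ge9 crit) (crit_min crit bw).
by rewrite card_block // leqNgt ltnS w8.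
Qed.

Let F t := [set L t (v i) | i : 'I_(nverts s) & label s t i \in filled s t].

Lemma filled_label t i :
  i < nverts s -> (L t (v i) \in F t) = (label s t i \in filled s t).
Proof.
move=> im; apply/imsetP/idP => [[[j jm] /=]|ic]; last first.
  by exists (Ordinal im); rewrite ?inE.
rewrite inE => /= jc eq_ij.
have [k [km lk vik]] := real_filled rv jm jc (real_in rv im) eq_ij.
by rewrite (real_inj rv im km vik) lk.
Qed.

(** Even without [separates], distinct filled labels name distinct classes, since every member of a
    filled class carries its label. The list thus does not overcount the destroyed classes. *)
Lemma size_filled t :
  uniq (filled s t) -> all (fun c => c \in labels s t) (filled s t) ->
  size (filled s t) <= #|F t|.
Proof.
move=> uc /allP cl.
pose r c := index c (labels s t).
have rm c : c \in filled s t -> r c < nverts s by move=> /cl/index_lt.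
have lr c : c \in filled s t -> label s t (r c) = c by move=> /cl/label_index.
pose h c := L t (v (r c)).
have hF c : c \in filled s t -> h c \in F t by move=> cc; rewrite filled_label ?rm ?lr.
have uh : uniq (map h (filled s t)).
  rewrite map_inj_in_uniq // => c d cc cd hcd.
  have rc : label s t (r d) \in filled s t by rewrite lr.
  have [k [km lk vk]] := real_filled rv (rm _ cd) rc (real_in rv (rm _ cc)) hcd.
  by rewrite -(lr c) // -(lr d) // -lk (real_inj rv (rm _ cc) km vk).
rewrite -(size_map h) cardE; apply: uniq_leq_size => // _ /mapP[c cc ->].
by rewrite mem_enum hF.
Qed.

Lemma trade_ok_false w qs ns : trade_ok s w qs ns -> False.
Proof.
case/and5P => uw wm w_lt /and3P[tq tn _] le_w.
have im : all (fun i => i < nverts s) (iota 0 (nverts s)).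
  by apply/allP => i; rewrite mem_iota.
have tc t : [&& all (is_class s t) (sel qs ns t),
   open_outside s t (sel qs ns t) w, uniq (filled s t)
   & all (fun c => c \in labels s t) (filled s t)] by case: t.
apply: (@critical_no_trade _ _ e S L (block (iota 0 (nverts s))) (block w) F
  (fun t => size (sel qs ns t))) => //.
- apply/subsetP => x; rewrite inE => /mapP[i]; rewrite mem_iota => /= i_lt ->.
  exact: real_in rv _ i_lt.
- apply/subsetP => x; rewrite !inE => /mapP[i /(allP wm) i_lt ->].
  by rewrite map_f // mem_iota.
- move=> t x xS /imsetP[[i i_lt] /=]; rewrite inE => /= ic Lx.
  have [j [jm _ ->]] := real_filled rv i_lt ic xS Lx.
  by rewrite inE map_f // mem_iota.
- move=> t; apply/subsetP => _ /imsetP[[i i_lt] _ ->].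
  by rewrite imset_f // (real_in rv).
- move=> t; have /and4P[cq oq _ _] := tc t; apply: coverable_blocks => // x.
  rewrite !inE => /andP[/mapP[i iw ->]]; rewrite filled_label ?(allP wm) // => ic.
  by exists i => //; have := allP oq _ iw; rewrite ic orbF.
- by rewrite !card_block ?iota_uniq // size_iota.
rewrite !card_block ?iota_uniq // size_iota.
have /and4P[_ _ u1 c1] := tc true; have /and4P[_ _ u2 c2] := tc false.
apply: leq_trans le_w _.
by rewrite -!addnA !leq_add2l leq_add ?size_filled.
Qed.

Hypothesis sv : separates L s v.

(** By separation the labels embed into the classes, so no class is charged for two labels. *)
Lemma surplus_le t :
  surplus s t <= \sum_(z in L t @: S) (#|fiber S L t z| - 2).
Proof.
pose r c := index c (labels s t).
have rm c : c \in labels s t -> r c < nverts s := @index_lt s t c.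
have lr c : c \in labels s t -> label s t (r c) = c := @label_index s t c.
pose h c := L t (v (r c)).
have uh : uniq (map h (undup (labels s t))).
  rewrite map_inj_in_uniq ?undup_uniq // => c d; rewrite !mem_undup => cc cd hcd.
  by rewrite -(lr c) // -(lr d) //; apply: sv; rewrite ?rm.
rewrite /surplus sumnE big_map.
apply: (@leq_trans (\sum_(c <- undup (labels s t)) (#|fiber S L t (h c)| - 2))).
  rewrite big_seq [X in _ <= X]big_seq; apply: leq_sum => c; rewrite mem_undup => cc.
  apply: leq_sub2r; rewrite count_map -size_filter -(size_map v) cardE.
  apply: uniq_leq_size.
    apply: uniq_real; first by rewrite filter_uniq ?iota_uniq.
    by apply/allP => i; rewrite mem_filter mem_iota => /andP[].
  move=> x /mapP[i]; rewrite mem_filter mem_iota => /= /andP[/eqP lic im] ->.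
  rewrite mem_enum inE (real_in rv) //=; apply/eqP.
  by apply: (real_label rv) => //; rewrite ?rm ?lr.
rewrite -(big_map h xpredT (fun z => #|fiber S L t z| - 2)) big_uniq //=.
rewrite [X in _ <= X](bigID (mem (map h (undup (labels s t))))) /=.
apply: leq_trans (leq_addr _ _).
rewrite [X in _ <= X](eq_bigl (mem (map h (undup (labels s t))))) // => z /=.
case: (boolP (z \in map _ _)) => [/mapP[c]|]; last by rewrite andbF.
by rewrite mem_undup => cc ->; rewrite andbT imset_f // (real_in rv) // rm.
Qed.

Lemma surplus_le2 : surplus s true + surplus s false <= 2.
Proof. by rewrite -(critical_surplus crit) leq_add ?surplus_le. Qed.

End Realized.

(** Composing a realization of [s] with [phi] gives one of [k], in the complement if [sw] holds. As
    [phi] may send different labels of [k] to one class, separation is not inherited and [k] has to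
    be refuted without it. *)
Lemma refuted_use sep k s sw phi :
  refuted false k -> embeds k s sw phi -> refuted sep s.
Proof.
move=> kr /and4P[/nilP k0 /allP phm uphi /= emb] V T e S L v crit rv _.
have {}phm i : i < nverts k -> phi i < nverts s.
  by move=> im; apply: phm; rewrite mem_iota.
have phi_inj i j : i < nverts k -> j < nverts k -> phi i = phi j -> i = j.
  by move=> im jm; apply: (mkseq_uniqP _ _ uphi).
have {}emb t i : i < nverts k ->
    (forall j, j < nverts k -> label k t i = label k t j ->
       label s (t (+) sw) (phi i) = label s (t (+) sw) (phi j)) /\
    (label k t i \in filled k t -> label s (t (+) sw) (phi i) \in filled s (t (+) sw) /\
       forall j, j < nverts s -> label s (t (+) sw) j = label s (t (+) sw) (phi i) ->
       exists l, [/\ l < nverts k, label k t l = label k t i & phi l = j]).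
  have {emb} : all (fun i =>
        all (fun j => (label k t i == label k t j) ==>
               (label s (t (+) sw) (phi i) == label s (t (+) sw) (phi j)))
            (iota 0 (nverts k)) &&
        ((label k t i \in filled k t) ==>
           (label s (t (+) sw) (phi i) \in filled s (t (+) sw)) &&
           all (fun j => (label s (t (+) sw) j == label s (t (+) sw) (phi i)) ==>
                  has (fun l => (label k t l == label k t i) && (phi l == j))
                      (iota 0 (nverts k)))
               (iota 0 (nverts s)))) (iota 0 (nverts k)).
    by case/and3P: emb; case: t.
  move=> /allP emb im; have /emb/andP[/allP e1 /implyP e2] : i \in iota 0 (nverts k).
    by rewrite mem_iota.
  split=> [j jm lij|/e2/andP[-> /allP e3]].
    by apply/eqP; move: lij => /eqP; apply/implyP/e1; rewrite mem_iota.
  split=> // j jm lij; have /e3/implyP : j \in iota 0 (nverts s) by rewrite mem_iota.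
  case/(_ _)/hasP => [|l]; first by apply/eqP.
  by rewrite mem_iota => /= lm /andP[/eqP ll /eqP pl]; exists l.
apply: (kr V T _ S _ (v \o phi) (critical_swap sw crit)) => //; split=> /=.
- by move=> i im; rewrite (real_in rv) ?phm.
- by move=> i j im jm /(real_inj rv (phm _ im) (phm _ jm)) /phi_inj; apply.
- move=> t i j im jm lij; apply: (real_label rv); rewrite ?phm //.
  by have [h _] := emb t i im; apply: h.
- move=> t i x im ic xS Lx; have [_ /(_ ic)[ic' hj]] := emb t i im.
  have [j [jm lj ->]] := real_filled rv (phm _ im) ic' xS Lx.
  by have [l [lm ll <-]] := hj j jm lj; exists l.
by move=> i j b; rewrite k0.
Qed.

Lemma refuted_split sep s i j :
  refuted sep (add_fact s i j true) -> refuted sep (add_fact s i j false) ->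
  refuted sep s.
Proof.
move=> r1 r0 V T e S L v crit rv sv.
have rb : realizes e S L (add_fact s i j (e (v i) (v j))) v.
  case: rv => v1 v2 v3 v4 v5; split=> // k l b; rewrite inE.
  by case/predU1P => [[-> -> ->]|/v5].
by case: (e _ _) rb => rb; [apply: r1 crit rb _ | apply: r0 crit rb _].
Qed.

Fixpoint all_refuted sep ss :=
  if ss is s :: ss' then refuted sep s /\ all_refuted sep ss' else True.

Lemma all_refuted_cat sep ss1 ss2 :
  all_refuted sep (ss1 ++ ss2) -> all_refuted sep ss1 /\ all_refuted sep ss2.
Proof. by elim: ss1 => //= s ss1 IH [? /IH[]]. Qed.

Lemma all_refuted_map sep (I : eqType) (f : I -> state) P (ds : seq I) d :
  all_refuted sep [seq s <- [seq f d | d <- ds] | P s] ->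
  d \in ds -> P (f d) -> refuted sep (f d).
Proof.
elim: ds => //= d' ds IH; rewrite inE.
case: ifP => [_ [r /IH h]|nP /IH h] /predU1P[->|/h] //.
by rewrite nP.
Qed.

Lemma all_refuted_nth sep ss s n :
  all_refuted sep ss -> n < size ss -> refuted sep (nth s ss n).
Proof. by elim: ss n => //= s' ss IH [|n] [r /IH] //; apply. Qed.

(** Either all members of the class c have been seen, or there is a further one, whose class of the
    other type is an old one or a new one. [children] contains every outcome that can occur. *)
Lemma refuted_grow s t c :
  c \in labels s t ->
  all (fun u => all (fun d => d < nverts s) (labels s u ++ filled s u))
      [:: true; false] ->
  nilp (facts s) ->
  all_refuted true (children s t c) -> refuted true s.
Proof.
move=> /mapP[i0]; rewrite mem_iota => /= i0m def_c lab_lt' /nilP no_facts.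
move=> /all_refuted_cat[ref_fill ref_extend] V T e S L v crit rv /(_ isT) sv.
have {lab_lt'} lab_lt u d : d \in labels s u ++ filled s u -> d < nverts s.
  have : all (fun d => d < nverts s) (labels s u ++ filled s u).
    by case/and3P: lab_lt'; case: u.
  by move/allP; apply.
have label_lt u i : i < nverts s -> label s u i < nverts s.
  by move=> im; apply: (lab_lt u); rewrite mem_cat map_f // mem_iota.
have [v1 v2 v3 v4 v5] := rv.
case: (pickP [pred x in S | (L t x == L t (v i0)) &&
                            (x \notin [seq v i | i <- iota 0 (nverts s)])]); last first.
  move=> full.
  have {full} cl x : x \in S -> L t x = L t (v i0) -> exists2 j, j < nverts s & x = v j.
    move=> xS Lx; have := full x; rewrite /= xS Lx eqxx /= => /negbFE/mapP[j].
    by rewrite mem_iota => jm ->; exists j.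
  have rc : realizes e S L (fill s t c) v.
    split=> //= u i x im; case: eqP => [->|_]; last exact: v4.
    rewrite inE => /predU1P[lic xS Lx|]; last exact: v4.
    have [j jm xj] := cl x xS (etrans Lx (v3 _ _ _ im i0m (etrans lic def_c))).
    by exists j; split=> //; apply: sv; rewrite // -xj.
  (* The filled child is absent when a single member has been seen, but a class without further
     members has at least two. *)
  case: ifP ref_fill => [_ [r _]|/negP[]]; first exact: r crit rc _.
  have [y [yS yi Ly]] := critical_class_gt1 t crit (v1 _ i0m).
  have [j jm yj] := cl y yS Ly.
  rewrite (_ : 2 = size [:: i0; j]) //; apply: uniq_leq_size.
    by rewrite /= inE andbT; apply: contraNneq yi => ->; rewrite yj.
  move=> i; rewrite !inE mem_filter mem_iota => /orP[]/eqP->.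
    by rewrite def_c eqxx.
  by rewrite jm def_c (sv t j i0) ?eqxx -?yj.
move=> x /and3P[xS /eqP Lx xv].
have {xv} x_new i : i < nverts s -> v i <> x.
  by move=> im vi; case/negP: xv; rewrite -vi map_f // mem_iota.
pose d := if [pick j : 'I_(nverts s) | L (~~ t) x == L (~~ t) (v j)] is Some j
          then label s (~~ t) j else nverts s.
pose v' i := if i == nverts s then x else v i.
have v'lt i : i < nverts s -> v' i = v i.
  by rewrite /v' => im; case: eqP => // ei; rewrite ei ltnn in im.
have d_label j : j < nverts s -> (L (~~ t) x == L (~~ t) (v j)) = (label s (~~ t) j == d).
  move=> jm; rewrite /d; case: pickP => [k /eqP ->|none].
    by apply/eqP/eqP => [/(sv _ _ _ (ltn_ord k) jm)//|/(v3 _ _ _ jm (ltn_ord k))].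
  by rewrite (none (Ordinal jm)); apply/esym; apply: ltn_eqF; apply: label_lt.
have c_label j : j < nverts s -> (L t x == L t (v j)) = (label s t j == c).
  move=> jm; rewrite Lx def_c.
  by apply/eqP/eqP => [/(sv _ _ _ i0m jm)|/(v3 _ _ _ jm i0m)].
have neqb (a b : bool) : a <> b -> a = ~~ b by case: a b => [] [].
have u_label u j : j < nverts s ->
    (L u x == L u (v j)) = (label s u j == if u == t then c else d).
  move=> jm; case: (u =P t) => [->|ut]; first exact: c_label.
  by rewrite (neqb _ _ ut) d_label.
have lt_neq i : i < nverts s -> (i == nverts s) = false by move=> im; apply: ltn_eqF.
have rv' : realizes e S L (extend s t c d) v'.
  split=> /=.
  - move=> i im; rewrite /v'; case: eqP => [//|/eqP ni].
    by apply: v1; rewrite ltn_neqAle ni.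
  - move=> i j; rewrite !ltnS (leq_eqVlt i) (leq_eqVlt j).
    move=> /predU1P[->|im] /predU1P[->|jm] //.
    + by rewrite /v' eqxx lt_neq // => /esym/x_new; case.
    + by rewrite /v' eqxx lt_neq // => /x_new; case.
    by rewrite !v'lt //; apply: v2.
  - move=> u i j; rewrite !ltnS (leq_eqVlt i) (leq_eqVlt j).
    move=> /predU1P[->|im] /predU1P[->|jm] //.
    + by rewrite /v' eqxx lt_neq // => /esym/eqP; rewrite -u_label // => /eqP.
    + by rewrite /v' eqxx lt_neq // => /eqP; rewrite -u_label // => /eqP.
    by rewrite !lt_neq // !v'lt //; apply: v3.
  - move=> u i y; rewrite ltnS (leq_eqVlt i) => /predU1P[->|im].
      (* The label of the new vertex is not filled: the fresh label exceeds all filled ones, and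
         with an old filled label [x] would be an old vertex. *)
      rewrite eqxx {1}/v' eqxx => ic yS Ly; exfalso.
      have [j jm lj] : exists2 j, j < nverts s & label s u j = if u == t then c else d.
        case: (u =P t) ic => [->|ut]; first by exists i0.
        rewrite (neqb _ _ ut).
        rewrite /d; case: pickP => [j _ _|_ oc]; first by exists j.
        by have := lab_lt (~~ t) (nverts s); rewrite mem_cat oc orbT ltnn => /(_ isT).
      rewrite -lj in ic; have /eqP Lxj : L u x == L u (v j) by rewrite u_label // lj.
      by have [k [km _ /esym/x_new]] := v4 u j x jm ic xS Lxj; case.
    rewrite lt_neq // v'lt // => ic yS Ly; have [j [jm lj ->]] := v4 u i y im ic yS Ly.
    by exists j; rewrite lt_neq // v'lt // ltnW.
  (* An old fact could mention the index [nverts s], where [v'] need not agree with [v]; hence the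
     demand for an empty list. *)
  by move=> i j b; rewrite no_facts.
have sv' : separates L (extend s t c d) v'.
  move=> u i j /=; rewrite !ltnS (leq_eqVlt i) (leq_eqVlt j).
    move=> /predU1P[->|im] /predU1P[->|jm] //.
  + by rewrite /v' eqxx lt_neq // => /eqP; rewrite u_label // => /eqP.
  + by rewrite /v' eqxx lt_neq // => /esym/eqP; rewrite u_label // => /eqP.
  by rewrite !lt_neq // !v'lt //; apply: sv.
(* The surplus filter discards no realized state, by [surplus_le2]; only the choice of [d] remains
   to be justified. *)
suff d_in : d \in other_labels s t c.
  have sur := surplus_le2 crit rv' sv'.
  exact: (all_refuted_map ref_extend d_in sur crit rv' (fun=> sv')).
rewrite inE mem_filter mem_undup.
rewrite /d; case: pickP => [j /eqP Lxj|_]; last by rewrite eqxx.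
apply/orP; right; rewrite map_f ?mem_iota ?ltn_ord // andbT; apply/andP; split.
  apply/negP => jc; have [k [km _ /esym/x_new]] := v4 _ _ _ (ltn_ord j) jc xS Lxj.
  exact.
apply/allP => k; rewrite mem_filter mem_iota => /= /andP[/eqP lk km].
apply/eqP => lkj; have /eqP Lk : L t x == L t (v k) by rewrite c_label // lk.
have Lk' : L (~~ t) x = L (~~ t) (v k).
  by rewrite Lxj; apply: v3; rewrite ?ltn_ord.
have xk : x != v k by apply/eqP => /esym/x_new; apply.
(* [x] and [v k] would share a class of either type and so be both adjacent and non-adjacent. *)
suff : t = ~~ t by clear; case: t.
rewrite -(crit_homog crit xS (v1 _ km) Lk' xk).
by rewrite (crit_homog crit xS (v1 _ km) Lk xk).
Qed.

Lemma run_refuted sep lib p ss :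
  all_refuted false lib -> run sep lib p ss -> all_refuted sep ss.
Proof.
move=> lib_ref; elim: p ss => [|i p IH] [|s ss] //=; try by case: i.
case: i => [i j|t c|w qs ns|w qs ns|n sw phi].
- by case/and3P => _ _ /IH[r1 [r0 ssr]]; split=> //; apply: refuted_split r1 r0.
- case/and5P => sepT cl lt nf /IH; case: sep sepT {IH} => // _.
  by case/all_refuted_cat => cr ssr; split=> //; apply: refuted_grow cl lt nf cr.
- case/andP => ok /IH; split=> // V T e S L v crit rv _.
  exact: (trade_ok_false crit rv ok).
- case/andP => ok /IH; split=> // V T e S L v crit rv _.
  exact: (bad_ok_false crit rv ok).
case/and3P => n_lt ok /IH; split=> //.
exact: (refuted_use (all_refuted_nth lib_ref n_lt) ok).
Qed.

(** * The fragments and the search *)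

(* The arguments ql and sl list, for each vertex, its clique and its stable set;
   qc and sc list the filled ones. *)
Definition pattern m ql sl qc sc :=
  State m (sel (nth 0 ql) (nth 0 sl)) (sel qc sc) [::].

(* Five consecutive nodes of degree 2 in B. *)
Definition chain := pattern 6
  [:: 0; 1; 1; 2; 2; 3] [:: 0; 0; 1; 1; 2; 2]
  [:: 1; 2] [:: 0; 1; 2].

(* A cycle of six nodes with two adjacent nodes of degree 3. *)
Definition hexagon1 := pattern 8
  [:: 0; 1; 1; 2; 2; 0; 0; 3] [:: 0; 0; 1; 1; 2; 2; 3; 2]
  [:: 0; 1; 2] [:: 0; 1; 2].

(* A cycle of six nodes with two nodes of degree 3 at distance 2. *)
Definition hexagon2 := pattern 8
  [:: 0; 1; 1; 2; 0; 2; 0; 2] [:: 0; 0; 1; 1; 2; 2; 3; 4]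
  [:: 0; 1; 2] [:: 0; 1; 2].

(* A node of degree 3 from which three paths of two nodes of degree 2 emanate. *)
Definition tripod := pattern 9
  [:: 0; 0; 0; 1; 2; 3; 1; 2; 3] [:: 0; 1; 2; 0; 1; 2; 3; 4; 5]
  [:: 0; 1; 2; 3] [:: 0; 1; 2].

(* A cycle of four nodes with a tail of three nodes of degree 2. *)
Definition lasso := pattern 8
  [:: 0; 0; 1; 1; 2; 2; 3; 3] [:: 0; 1; 1; 0; 0; 2; 2; 3]
  [:: 0; 1; 2; 3] [:: 0; 1; 2].

(* Two cycles of four nodes joined by a path of one, two or three edges. *)
Definition dumbbell1 := pattern 9
  [:: 0; 0; 1; 1; 2; 2; 3; 3; 2] [:: 0; 1; 1; 0; 0; 2; 2; 3; 3]
  [:: 0; 1; 2; 3] [:: 0; 1; 2; 3].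

Definition dumbbell2 := pattern 10
  [:: 0; 0; 1; 1; 2; 2; 3; 3; 4; 4] [:: 0; 1; 1; 0; 0; 2; 2; 3; 3; 2]
  [:: 0; 1; 2; 3; 4] [:: 0; 1; 2; 3].

Definition dumbbell3 := pattern 11
  [:: 0; 0; 1; 1; 2; 2; 3; 3; 4; 4; 3] [:: 0; 1; 1; 0; 0; 2; 2; 3; 3; 4; 4]
  [:: 0; 1; 2; 3; 4] [:: 0; 1; 2; 3; 4].

Definition patterns :=
  [:: chain; hexagon1; hexagon2; tripod; lasso; dumbbell1; dumbbell2; dumbbell3].

(** The decision trees of the fragments, in the order of [patterns] and in preorder, the adjacent
    branch of each [Split] first. *)
Definition pattern_script : seq instr := [::
  Split 0 3; Split 1 4;
  Trade [:: 0; 1; 4; 5] [:: [:: 1; 4]] [:: [:: 4; 5]; [:: 0; 1]]; Split 0 4;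
  Split 1 5; Split 2 5;
  Bad [:: 0; 1; 2; 3; 4; 5] [:: [:: 1; 2; 5]; [:: 0; 3; 4]]
    [:: [:: 4; 5]; [:: 2; 3]; [:: 0; 1]];
  Trade [:: 0; 1; 2; 5] [:: [:: 1; 2]] [:: [:: 2; 5]; [:: 0; 1]];
  Trade [:: 1; 2; 3; 4; 5] [:: [:: 3; 4]; [:: 1; 2]]
    [:: [:: 1; 4; 5]; [:: 2; 3]];
  Trade [:: 0; 1; 2; 3; 4] [:: [:: 3; 4]; [:: 1; 2]]
    [:: [:: 0; 1; 4]; [:: 2; 3]];
  Trade [:: 0; 3; 4; 5] [:: [:: 3; 4]] [:: [:: 4; 5]; [:: 0; 3]]; Split 0 3;
  Split 1 4;
  Trade [:: 0; 1; 4; 5; 6; 7] [:: [:: 0; 5; 6]; [:: 1; 4]]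
    [:: [:: 4; 5; 7]; [:: 0; 1]]; Split 1 7; Split 2 7;
  Bad [:: 0; 1; 2; 3; 4; 5; 7] [:: [:: 1; 2; 7]; [:: 0; 5]; [:: 3; 4]]
    [:: [:: 4; 5; 7]; [:: 2; 3]; [:: 0; 1]]; Split 2 5; Split 0 2;
  Bad [:: 0; 1; 2; 3; 4; 5; 7] [:: [:: 1; 7]; [:: 0; 2; 5]; [:: 3; 4]]
    [:: [:: 4; 5; 7]; [:: 2; 3]; [:: 0; 1]]; Split 0 4;
  Bad [:: 0; 1; 2; 3; 4; 5; 7] [:: [:: 1; 7]; [:: 2; 5]; [:: 0; 3; 4]]
    [:: [:: 4; 5; 7]; [:: 2; 3]; [:: 0; 1]]; Split 2 6;
  Trade [:: 2; 3; 4; 5; 6; 7] [:: [:: 2; 5; 6]; [:: 3; 4]]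
    [:: [:: 4; 5; 7]; [:: 2; 3]]; Split 3 5; Split 3 6;
  Trade [:: 0; 1; 2; 3; 5; 6; 7] [:: [:: 0; 3; 5; 6]; [:: 1; 2]]
    [:: [:: 5; 7]; [:: 2; 3]; [:: 0; 1]];
  Bad [:: 0; 1; 2; 3; 4; 6] [:: [:: 0; 6]; [:: 3; 4]; [:: 1; 2]]
    [:: [:: 2; 3; 6]; [:: 0; 1; 4]];
  Bad [:: 0; 1; 2; 3; 4; 5; 6] [:: [:: 0; 5; 6]; [:: 3; 4]; [:: 1; 2]]
    [:: [:: 2; 6]; [:: 3; 5]; [:: 0; 1; 4]];
  Trade [:: 0; 1; 2; 5; 6; 7] [:: [:: 0; 5; 6]; [:: 1; 2]]
    [:: [:: 2; 5; 7]; [:: 0; 1]]; Split 1 5; Split 2 5; Split 0 4;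
  Trade [:: 0; 1; 2; 3; 4; 5; 7] [:: [:: 1; 2; 5]; [:: 0; 3; 4]]
    [:: [:: 4; 5; 7]; [:: 2; 3]; [:: 0; 1]]; Split 0 7;
  Bad [:: 0; 1; 2; 3; 4; 5; 7] [:: [:: 0; 7]; [:: 1; 2; 5]; [:: 3; 4]]
    [:: [:: 5; 7]; [:: 0; 1; 4]; [:: 2; 3]];
  Trade [:: 0; 1; 2; 3; 4; 6; 7] [:: [:: 0; 6]; [:: 3; 4]; [:: 1; 2]]
    [:: [:: 0; 1; 4; 7]; [:: 2; 3]]; Split 0 7; Split 2 7; Split 0 2;
  Bad [:: 0; 1; 2; 3; 4; 5; 7] [:: [:: 0; 2; 7]; [:: 1; 5]; [:: 3; 4]]
    [:: [:: 4; 5; 7]; [:: 2; 3]; [:: 0; 1]]; Split 3 5; Split 3 6;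
  Trade [:: 0; 1; 2; 3; 5; 6; 7] [:: [:: 0; 3; 5; 6]; [:: 1; 2]]
    [:: [:: 5; 7]; [:: 2; 3]; [:: 0; 1]];
  Bad [:: 0; 2; 3; 4; 5; 6; 7] [:: [:: 2; 7]; [:: 0; 5; 6]; [:: 3; 4]]
    [:: [:: 4; 5; 7]; [:: 3; 6]; [:: 0; 2]];
  Trade [:: 1; 2; 3; 4; 5; 6; 7] [:: [:: 5; 6]; [:: 3; 4]; [:: 1; 2]]
    [:: [:: 1; 4; 7]; [:: 2; 3; 5]];
  Trade [:: 0; 1; 2; 5; 6; 7] [:: [:: 0; 5; 6]; [:: 1; 2]]
    [:: [:: 2; 5; 7]; [:: 0; 1]];
  Trade [:: 0; 1; 2; 5; 6; 7] [:: [:: 0; 5; 6]; [:: 1; 2]]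
    [:: [:: 0; 1; 7]; [:: 2; 5]];
  Trade [:: 1; 2; 3; 4; 5; 6; 7] [:: [:: 5; 6]; [:: 3; 4]; [:: 1; 2]]
    [:: [:: 1; 4; 5; 7]; [:: 2; 3]];
  Trade [:: 0; 3; 4; 5; 6; 7] [:: [:: 0; 5; 6]; [:: 3; 4]]
    [:: [:: 4; 5; 7]; [:: 0; 3]]; Split 0 3; Split 6 7; Split 2 6; Split 2 4;
  Trade [:: 2; 3; 4; 5; 6; 7] [:: [:: 3; 5; 7]; [:: 2; 4; 6]]
    [:: [:: 4; 5]; [:: 2; 3]]; Split 2 5; Split 3 4; Split 1 5;
  Bad [:: 0; 1; 2; 3; 4; 5] [:: [:: 1; 2; 5]; [:: 0; 3; 4]]
    [:: [:: 4; 5]; [:: 2; 3]; [:: 0; 1]]; Split 1 4; Split 1 6;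
  Trade [:: 1; 2; 3; 5; 6; 7] [:: [:: 3; 5; 7]; [:: 1; 2; 6]]
    [:: [:: 1; 5]; [:: 2; 3]]; Split 0 7; Split 3 6;
  Trade [:: 0; 1; 2; 3; 6; 7] [:: [:: 0; 3; 6; 7]; [:: 1; 2]]
    [:: [:: 2; 3]; [:: 0; 1]]; Split 2 7; Split 0 2;
  Trade [:: 0; 1; 2; 4; 6; 7] [:: [:: 0; 2; 6; 7]; [:: 1; 4]]
    [:: [:: 2; 4]; [:: 0; 1]];
  Trade [:: 0; 2; 4; 5; 6; 7] [:: [:: 2; 5; 7]; [:: 0; 4; 6]]
    [:: [:: 4; 5]; [:: 0; 2]];
  Bad [:: 0; 1; 2; 3; 4; 5; 6; 7] [:: [:: 3; 5; 7]; [:: 0; 4; 6]; [:: 1; 2]]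
    [:: [:: 2; 7]; [:: 3; 6]; [:: 4; 5]; [:: 0; 1]];
  Bad [:: 0; 1; 2; 3; 4; 5; 6; 7] [:: [:: 3; 5; 7]; [:: 0; 4; 6]; [:: 1; 2]]
    [:: [:: 0; 7]; [:: 1; 6]; [:: 4; 5]; [:: 2; 3]];
  Trade [:: 1; 2; 3; 4; 5; 6; 7] [:: [:: 3; 5; 7]; [:: 4; 6]; [:: 1; 2]]
    [:: [:: 1; 4; 5]; [:: 2; 3]];
  Trade [:: 0; 1; 2; 3; 4; 6; 7] [:: [:: 3; 7]; [:: 0; 4; 6]; [:: 1; 2]]
    [:: [:: 2; 3; 4]; [:: 0; 1]];
  Trade [:: 0; 1; 2; 4; 5; 6; 7] [:: [:: 5; 7]; [:: 0; 4; 6]; [:: 1; 2]]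
    [:: [:: 2; 4; 5]; [:: 0; 1]]; Split 3 6; Split 0 7;
  Trade [:: 0; 1; 2; 3; 6; 7] [:: [:: 0; 3; 6; 7]; [:: 1; 2]]
    [:: [:: 2; 3]; [:: 0; 1]]; Split 1 3; Split 1 6; Split 1 7; Split 1 5;
  Trade [:: 0; 1; 4; 5; 6; 7] [:: [:: 1; 5; 7]; [:: 0; 4; 6]]
    [:: [:: 4; 5]; [:: 0; 1]]; Split 0 5; Split 1 4; Split 2 4;
  Bad [:: 0; 1; 2; 3; 4; 5] [:: [:: 0; 3; 5]; [:: 1; 2; 4]]
    [:: [:: 4; 5]; [:: 2; 3]; [:: 0; 1]]; Split 2 5;
  Trade [:: 1; 2; 3; 5; 6; 7] [:: [:: 1; 3; 6; 7]; [:: 2; 5]]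
    [:: [:: 1; 5]; [:: 2; 3]];
  Trade [:: 0; 1; 2; 4; 5; 6; 7] [:: [:: 5; 7]; [:: 0; 4; 6]; [:: 1; 2]]
    [:: [:: 2; 4; 5]; [:: 0; 1]];
  Trade [:: 1; 2; 3; 4; 5; 6; 7] [:: [:: 3; 5; 7]; [:: 4; 6]; [:: 1; 2]]
    [:: [:: 1; 4; 5]; [:: 2; 3]];
  Trade [:: 0; 1; 2; 3; 5; 6; 7] [:: [:: 5; 7]; [:: 0; 3; 6]; [:: 1; 2]]
    [:: [:: 0; 1; 5]; [:: 2; 3]];
  Bad [:: 0; 1; 2; 3; 4; 5; 7] [:: [:: 3; 5; 7]; [:: 0; 4]; [:: 1; 2]]
    [:: [:: 0; 1; 7]; [:: 4; 5]; [:: 2; 3]];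
  Bad [:: 0; 1; 2; 3; 4; 5; 6; 7] [:: [:: 3; 5; 7]; [:: 0; 4; 6]; [:: 1; 2]]
    [:: [:: 0; 7]; [:: 1; 6]; [:: 4; 5]; [:: 2; 3]];
  Bad [:: 0; 1; 2; 3; 4; 5; 6; 7] [:: [:: 3; 5; 7]; [:: 0; 4; 6]; [:: 1; 2]]
    [:: [:: 0; 7]; [:: 2; 6]; [:: 4; 5]; [:: 1; 3]];
  Bad [:: 0; 1; 2; 3; 4; 5; 6] [:: [:: 0; 4; 6]; [:: 3; 5]; [:: 1; 2]]
    [:: [:: 2; 3; 6]; [:: 4; 5]; [:: 0; 1]];
  Bad [:: 0; 1; 2; 3; 4; 5; 6; 7] [:: [:: 3; 5; 7]; [:: 0; 4; 6]; [:: 1; 2]]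
    [:: [:: 6; 7]; [:: 4; 5]; [:: 2; 3]; [:: 0; 1]];
  Trade [:: 0; 3; 4; 5; 6; 7] [:: [:: 3; 5; 7]; [:: 0; 4; 6]]
    [:: [:: 4; 5]; [:: 0; 3]]; Split 4 5; Split 4 8;
  Trade [:: 0; 1; 2; 3; 4; 5; 6; 8] [:: [:: 4; 5; 8]; [:: 3; 6]; [:: 0; 1; 2]]
    [:: [:: 2; 5]; [:: 1; 4]; [:: 0; 3]]; Split 5 7;
  Trade [:: 0; 1; 2; 3; 4; 5; 6; 7] [:: [:: 4; 5; 7]; [:: 3; 6]; [:: 0; 1; 2]]
    [:: [:: 2; 5]; [:: 1; 4]; [:: 0; 3]]; Split 3 5; Split 2 7; Split 0 7;
  Trade [:: 0; 2; 3; 5; 6; 7; 8] [:: [:: 5; 8]; [:: 0; 2; 7]; [:: 3; 6]]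
    [:: [:: 2; 5]; [:: 0; 3]]; Split 1 8; Split 0 8;
  Trade [:: 0; 1; 3; 4; 6; 7; 8] [:: [:: 0; 1; 8]; [:: 4; 7]; [:: 3; 6]]
    [:: [:: 1; 4]; [:: 0; 3]]; Split 3 4;
  Bad [:: 0; 1; 2; 3; 4; 5] [:: [:: 3; 4; 5]; [:: 0; 1; 2]]
    [:: [:: 2; 5]; [:: 1; 4]; [:: 0; 3]]; Split 0 4; Split 3 7; Split 3 8;
  Trade [:: 0; 1; 2; 3; 4; 5; 7; 8] [:: [:: 3; 5; 8]; [:: 4; 7]; [:: 0; 1; 2]]
    [:: [:: 2; 5]; [:: 1; 4]; [:: 0; 3]]; Split 0 5;
  Bad [:: 0; 1; 3; 4; 5; 7; 8] [:: [:: 1; 8]; [:: 3; 7]; [:: 0; 4; 5]]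
    [:: [:: 0; 3; 8]; [:: 5; 7]; [:: 1; 4]];
  Bad [:: 0; 3; 4; 5; 7; 8] [:: [:: 5; 8]; [:: 3; 7]; [:: 0; 4]]
    [:: [:: 3; 4; 8]; [:: 0; 5; 7]];
  Bad [:: 0; 1; 2; 3; 4; 5; 7] [:: [:: 4; 7]; [:: 3; 5]; [:: 0; 1; 2]]
    [:: [:: 0; 3; 7]; [:: 2; 5]; [:: 1; 4]];
  Trade [:: 0; 2; 3; 4; 5; 6; 7; 8]
    [:: [:: 5; 8]; [:: 4; 7]; [:: 3; 6]; [:: 0; 2]]
    [:: [:: 2; 5]; [:: 0; 3; 4]];
  Bad [:: 0; 1; 2; 4; 5; 7; 8] [:: [:: 5; 8]; [:: 4; 7]; [:: 0; 1; 2]]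
    [:: [:: 1; 4; 8]; [:: 0; 7]; [:: 2; 5]];
  Bad [:: 0; 1; 2; 3; 4; 5; 7] [:: [:: 4; 7]; [:: 3; 5]; [:: 0; 1; 2]]
    [:: [:: 2; 5; 7]; [:: 1; 4]; [:: 0; 3]]; Split 0 5; Split 2 3; Split 2 7;
  Split 0 7;
  Trade [:: 0; 2; 3; 5; 6; 7; 8] [:: [:: 5; 8]; [:: 0; 2; 7]; [:: 3; 6]]
    [:: [:: 2; 5]; [:: 0; 3]]; Split 0 8;
  Trade [:: 0; 2; 3; 5; 6; 7; 8] [:: [:: 0; 5; 8]; [:: 2; 7]; [:: 3; 6]]
    [:: [:: 2; 5]; [:: 0; 3]]; Split 1 8; Split 1 5;
  Trade [:: 1; 3; 4; 5; 6; 7; 8] [:: [:: 1; 5; 8]; [:: 4; 7]; [:: 3; 6]]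
    [:: [:: 3; 5]; [:: 1; 4]]; Split 7 8; Split 1 7;
  Trade [:: 0; 1; 3; 5; 6; 7; 8] [:: [:: 1; 7; 8]; [:: 3; 6]; [:: 0; 5]]
    [:: [:: 1; 5]; [:: 0; 3]]; Split 0 4; Split 1 3;
  Trade [:: 0; 1; 2; 3; 4; 5; 7; 8] [:: [:: 7; 8]; [:: 0; 4; 5]; [:: 1; 2; 3]]
    [:: [:: 2; 5]; [:: 1; 4]; [:: 0; 3]]; Split 2 4; Split 2 6;
  Trade [:: 0; 2; 3; 5; 6; 7; 8] [:: [:: 7; 8]; [:: 2; 3; 6]; [:: 0; 5]]
    [:: [:: 2; 5]; [:: 0; 3]];
  Bad [:: 0; 1; 2; 3; 5; 6; 8] [:: [:: 5; 8]; [:: 3; 6]; [:: 0; 1; 2]]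
    [:: [:: 0; 8]; [:: 2; 6]; [:: 1; 3; 5]];
  Trade [:: 1; 2; 3; 4; 5; 6; 7; 8]
    [:: [:: 1; 8]; [:: 2; 7]; [:: 3; 6]; [:: 4; 5]]
    [:: [:: 1; 3; 5]; [:: 2; 4]];
  Bad [:: 0; 1; 4; 5; 7; 8] [:: [:: 1; 8]; [:: 4; 7]; [:: 0; 5]]
    [:: [:: 0; 4; 8]; [:: 1; 5; 7]];
  Bad [:: 0; 1; 2; 4; 5; 7; 8] [:: [:: 5; 8]; [:: 4; 7]; [:: 0; 1; 2]]
    [:: [:: 0; 7; 8]; [:: 2; 5]; [:: 1; 4]];
  Bad [:: 0; 1; 2; 4; 5; 7; 8] [:: [:: 5; 8]; [:: 4; 7]; [:: 0; 1; 2]]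
    [:: [:: 1; 4; 8]; [:: 0; 7]; [:: 2; 5]]; Split 0 8;
  Bad [:: 0; 2; 3; 4; 5; 7; 8] [:: [:: 0; 5; 8]; [:: 4; 7]; [:: 2; 3]]
    [:: [:: 4; 8]; [:: 2; 5; 7]; [:: 0; 3]];
  Bad [:: 0; 1; 2; 4; 5; 7; 8] [:: [:: 5; 8]; [:: 4; 7]; [:: 0; 1; 2]]
    [:: [:: 0; 8]; [:: 2; 5; 7]; [:: 1; 4]];
  Trade [:: 1; 2; 3; 4; 5; 6; 7; 8]
    [:: [:: 5; 8]; [:: 4; 7]; [:: 3; 6]; [:: 1; 2]]
    [:: [:: 2; 3; 5]; [:: 1; 4]];
  Trade [:: 0; 1; 3; 4; 5; 6; 7; 8]
    [:: [:: 5; 8]; [:: 4; 7]; [:: 3; 6]; [:: 0; 1]]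
    [:: [:: 0; 3; 5]; [:: 1; 4]]; Split 1 5; Split 2 4; Split 3 5; Split 3 8;
  Trade [:: 0; 1; 2; 3; 4; 5; 7; 8] [:: [:: 3; 5; 8]; [:: 4; 7]; [:: 0; 1; 2]]
    [:: [:: 2; 5]; [:: 1; 4]; [:: 0; 3]]; Split 5 6;
  Trade [:: 0; 1; 2; 3; 4; 5; 6; 7] [:: [:: 4; 7]; [:: 3; 5; 6]; [:: 0; 1; 2]]
    [:: [:: 2; 5]; [:: 1; 4]; [:: 0; 3]]; Split 3 4; Split 0 8; Split 0 5;
  Trade [:: 0; 3; 4; 5; 6; 7; 8] [:: [:: 0; 5; 8]; [:: 4; 7]; [:: 3; 6]]
    [:: [:: 4; 5]; [:: 0; 3]]; Split 1 8;
  Trade [:: 0; 1; 3; 4; 6; 7; 8] [:: [:: 0; 1; 8]; [:: 4; 7]; [:: 3; 6]]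
    [:: [:: 1; 4]; [:: 0; 3]]; Split 2 6; Split 3 7;
  Trade [:: 0; 1; 2; 3; 4; 5; 7; 8] [:: [:: 5; 8]; [:: 3; 4; 7]; [:: 0; 1; 2]]
    [:: [:: 2; 5]; [:: 1; 4]; [:: 0; 3]]; Split 0 7; Split 0 4;
  Trade [:: 0; 3; 4; 5; 6; 7; 8] [:: [:: 5; 8]; [:: 0; 4; 7]; [:: 3; 6]]
    [:: [:: 4; 5]; [:: 0; 3]]; Split 1 3;
  Bad [:: 0; 1; 3; 4; 5; 7; 8] [:: [:: 0; 8]; [:: 4; 7]; [:: 1; 3; 5]]
    [:: [:: 1; 8]; [:: 3; 7]; [:: 0; 4; 5]];
  Trade [:: 0; 1; 3; 4; 5; 6; 7; 8]
    [:: [:: 0; 8]; [:: 4; 7]; [:: 3; 6]; [:: 1; 5]]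
    [:: [:: 0; 4; 5]; [:: 1; 3]];
  Bad [:: 0; 1; 2; 3; 4; 5; 7] [:: [:: 4; 7]; [:: 3; 5]; [:: 0; 1; 2]]
    [:: [:: 0; 3; 7]; [:: 2; 5]; [:: 1; 4]];
  Bad [:: 0; 1; 2; 3; 5; 6; 8] [:: [:: 5; 8]; [:: 3; 6]; [:: 0; 1; 2]]
    [:: [:: 1; 8]; [:: 2; 5; 6]; [:: 0; 3]];
  Bad [:: 0; 1; 2; 3; 4; 5; 8] [:: [:: 5; 8]; [:: 3; 4]; [:: 0; 1; 2]]
    [:: [:: 0; 3; 8]; [:: 2; 5]; [:: 1; 4]]; Split 0 4; Split 1 3;
  Bad [:: 0; 1; 2; 3; 4; 5] [:: [:: 1; 3; 5]; [:: 0; 2; 4]]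
    [:: [:: 2; 5]; [:: 1; 4]; [:: 0; 3]];
  Trade [:: 1; 2; 3; 4; 5; 6; 7; 8]
    [:: [:: 5; 8]; [:: 4; 7]; [:: 3; 6]; [:: 1; 2]]
    [:: [:: 2; 5]; [:: 1; 3; 4]];
  Trade [:: 0; 2; 3; 4; 5; 6; 7; 8]
    [:: [:: 5; 8]; [:: 4; 7]; [:: 3; 6]; [:: 0; 2]]
    [:: [:: 2; 5]; [:: 0; 3; 4]]; Split 0 5; Split 2 3; Split 3 4;
  Bad [:: 0; 1; 2; 3; 4; 5] [:: [:: 0; 1; 5]; [:: 2; 3; 4]]
    [:: [:: 2; 5]; [:: 1; 4]; [:: 0; 3]];
  Trade [:: 3; 4; 5; 6; 7; 8] [:: [:: 5; 8]; [:: 4; 7]; [:: 3; 6]]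
    [:: [:: 3; 4; 5]];
  Trade [:: 1; 2; 3; 4; 5; 6; 7; 8]
    [:: [:: 5; 8]; [:: 4; 7]; [:: 3; 6]; [:: 1; 2]]
    [:: [:: 2; 3; 5]; [:: 1; 4]];
  Trade [:: 0; 1; 3; 4; 5; 6; 7; 8]
    [:: [:: 5; 8]; [:: 4; 7]; [:: 3; 6]; [:: 0; 1]]
    [:: [:: 0; 3; 5]; [:: 1; 4]];
  Trade [:: 0; 2; 3; 4; 5; 6; 7; 8]
    [:: [:: 5; 8]; [:: 4; 7]; [:: 3; 6]; [:: 0; 2]]
    [:: [:: 2; 4; 5]; [:: 0; 3]];
  Trade [:: 0; 1; 3; 4; 5; 6; 7; 8]
    [:: [:: 5; 8]; [:: 4; 7]; [:: 3; 6]; [:: 0; 1]]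
    [:: [:: 1; 4; 5]; [:: 0; 3]]; Split 4 7;
  Trade [:: 0; 1; 2; 3; 4; 7] [:: [:: 4; 7]; [:: 2; 3]; [:: 0; 1]]
    [:: [:: 0; 3; 4]; [:: 1; 2]]; Split 0 7; Split 0 6;
  Trade [:: 0; 4; 5; 6; 7] [:: [:: 0; 6; 7]; [:: 4; 5]]
    [:: [:: 5; 6]; [:: 0; 4]]; Split 1 4;
  Trade [:: 0; 1; 2; 3; 4; 7] [:: [:: 0; 7]; [:: 1; 4]; [:: 2; 3]]
    [:: [:: 0; 3; 4]; [:: 1; 2]]; Split 0 5; Split 1 5;
  Trade [:: 0; 1; 2; 3; 5; 6; 7] [:: [:: 6; 7]; [:: 0; 1; 5]; [:: 2; 3]]
    [:: [:: 5; 6]; [:: 0; 3]; [:: 1; 2]]; Split 1 6; Split 1 7;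
  Trade [:: 0; 1; 2; 3; 7] [:: [:: 0; 1; 7]; [:: 2; 3]]
    [:: [:: 0; 3]; [:: 1; 2]]; Split 2 5; Split 2 4;
  Trade [:: 0; 1; 2; 4; 5; 6; 7] [:: [:: 0; 7]; [:: 1; 6]; [:: 2; 4; 5]]
    [:: [:: 5; 6]; [:: 0; 4]; [:: 1; 2]]; Split 2 7;
  Trade [:: 1; 2; 4; 5; 6; 7] [:: [:: 2; 7]; [:: 1; 6]; [:: 4; 5]]
    [:: [:: 5; 6]; [:: 1; 2; 4]];
  Bad [:: 0; 1; 2; 3; 4; 5; 6; 7]
    [:: [:: 0; 7]; [:: 1; 6]; [:: 4; 5]; [:: 2; 3]]
    [:: [:: 1; 2; 7]; [:: 5; 6]; [:: 0; 3; 4]];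
  Trade [:: 0; 2; 3; 4; 5; 7] [:: [:: 0; 7]; [:: 4; 5]; [:: 2; 3]]
    [:: [:: 2; 5]; [:: 0; 3; 4]];
  Trade [:: 0; 1; 4; 5; 6; 7] [:: [:: 6; 7]; [:: 4; 5]; [:: 0; 1]]
    [:: [:: 1; 5; 6]; [:: 0; 4]];
  Trade [:: 0; 1; 4; 5; 6; 7] [:: [:: 6; 7]; [:: 4; 5]; [:: 0; 1]]
    [:: [:: 0; 5; 6]; [:: 1; 4]]; Split 3 7; Split 0 6;
  Trade [:: 0; 3; 4; 5; 6; 7] [:: [:: 3; 7]; [:: 0; 6]; [:: 4; 5]]
    [:: [:: 5; 6]; [:: 0; 3; 4]]; Split 1 5; Split 0 5;
  Trade [:: 0; 1; 2; 3; 5; 6; 7] [:: [:: 6; 7]; [:: 0; 1; 5]; [:: 2; 3]]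
    [:: [:: 5; 6]; [:: 0; 3]; [:: 1; 2]]; Split 1 4;
  Trade [:: 1; 2; 3; 4; 5; 6; 7] [:: [:: 6; 7]; [:: 1; 4; 5]; [:: 2; 3]]
    [:: [:: 5; 6]; [:: 3; 4]; [:: 1; 2]];
  Trade [:: 0; 1; 4; 5; 6; 7] [:: [:: 6; 7]; [:: 4; 5]; [:: 0; 1]]
    [:: [:: 0; 5; 6]; [:: 1; 4]];
  Trade [:: 0; 1; 3; 4; 5; 7] [:: [:: 3; 7]; [:: 4; 5]; [:: 0; 1]]
    [:: [:: 1; 5]; [:: 0; 3; 4]];
  Bad [:: 0; 1; 2; 3; 4; 5; 6; 7]
    [:: [:: 6; 7]; [:: 4; 5]; [:: 2; 3]; [:: 0; 1]]
    [:: [:: 0; 3; 4; 7]; [:: 5; 6]; [:: 1; 2]]; Split 2 7; Split 2 6;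
  Trade [:: 0; 1; 2; 4; 5; 6; 7; 8] [:: [:: 4; 5; 8]; [:: 2; 6; 7]; [:: 0; 1]]
    [:: [:: 7; 8]; [:: 5; 6]; [:: 0; 4]; [:: 1; 2]]; Split 1 6; Split 0 6;
  Trade [:: 0; 1; 2; 3; 4; 5; 6] [:: [:: 0; 1; 6]; [:: 4; 5]; [:: 2; 3]]
    [:: [:: 5; 6]; [:: 0; 3; 4]; [:: 1; 2]]; Split 1 7;
  Trade [:: 1; 2; 3; 4; 5; 6; 7; 8] [:: [:: 4; 5; 8]; [:: 1; 6; 7]; [:: 2; 3]]
    [:: [:: 7; 8]; [:: 5; 6]; [:: 3; 4]; [:: 1; 2]]; Split 1 8; Split 2 5;
  Split 3 7;
  Trade [:: 0; 1; 2; 3; 4; 7; 8] [:: [:: 4; 8]; [:: 2; 3; 7]; [:: 0; 1]]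
    [:: [:: 7; 8]; [:: 0; 3; 4]; [:: 1; 2]]; Split 3 6; Split 0 7;
  Trade [:: 0; 3; 4; 5; 6; 7; 8] [:: [:: 4; 5; 8]; [:: 0; 7]; [:: 3; 6]]
    [:: [:: 7; 8]; [:: 5; 6]; [:: 0; 3; 4]]; Split 1 3;
  Trade [:: 1; 2; 3; 4; 5; 6; 7; 8] [:: [:: 4; 5; 8]; [:: 2; 7]; [:: 1; 3; 6]]
    [:: [:: 7; 8]; [:: 5; 6]; [:: 3; 4]; [:: 1; 2]]; Split 0 2; Split 2 4;
  Trade [:: 0; 1; 2; 3; 4; 5; 6] [:: [:: 3; 6]; [:: 2; 4; 5]; [:: 0; 1]]
    [:: [:: 5; 6]; [:: 0; 3; 4]; [:: 1; 2]]; Split 0 5; Split 1 4;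
  Trade [:: 0; 1; 2; 3; 4; 5; 6] [:: [:: 3; 6]; [:: 0; 2; 5]; [:: 1; 4]]
    [:: [:: 5; 6]; [:: 0; 3; 4]; [:: 1; 2]];
  Trade [:: 1; 2; 4; 5; 6; 7; 8] [:: [:: 4; 5; 8]; [:: 2; 7]; [:: 1; 6]]
    [:: [:: 7; 8]; [:: 5; 6]; [:: 1; 2; 4]];
  Trade [:: 0; 2; 4; 5; 6; 7; 8] [:: [:: 4; 5; 8]; [:: 6; 7]; [:: 0; 2]]
    [:: [:: 7; 8]; [:: 0; 5; 6]; [:: 2; 4]];
  Trade [:: 0; 1; 2; 3; 6; 7] [:: [:: 2; 7]; [:: 3; 6]; [:: 0; 1]]
    [:: [:: 1; 3; 7]; [:: 0; 2; 6]]; Split 0 8;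
  Trade [:: 0; 1; 2; 3; 6; 7; 8] [:: [:: 0; 1; 8]; [:: 6; 7]; [:: 2; 3]]
    [:: [:: 7; 8]; [:: 0; 3; 6]; [:: 1; 2]]; Split 4 6; Split 3 5;
  Trade [:: 0; 1; 2; 3; 4; 5; 6] [:: [:: 4; 6]; [:: 2; 3; 5]; [:: 0; 1]]
    [:: [:: 5; 6]; [:: 0; 3; 4]; [:: 1; 2]]; Split 0 7; Split 0 2;
  Trade [:: 0; 1; 2; 4; 5; 6; 7; 8] [:: [:: 4; 5; 8]; [:: 0; 2; 7]; [:: 1; 6]]
    [:: [:: 7; 8]; [:: 5; 6]; [:: 0; 4]; [:: 1; 2]]; Split 1 3; Split 1 4;
  Trade [:: 0; 1; 2; 3; 4; 6; 7] [:: [:: 0; 7]; [:: 1; 4; 6]; [:: 2; 3]]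
    [:: [:: 1; 7]; [:: 2; 6]; [:: 0; 3; 4]];
  Trade [:: 1; 3; 4; 5; 6; 7; 8] [:: [:: 4; 5; 8]; [:: 6; 7]; [:: 1; 3]]
    [:: [:: 7; 8]; [:: 3; 5; 6]; [:: 1; 4]];
  Trade [:: 0; 1; 2; 3; 6; 7] [:: [:: 0; 7]; [:: 1; 6]; [:: 2; 3]]
    [:: [:: 1; 3; 7]; [:: 0; 2; 6]];
  Trade [:: 0; 1; 2; 3; 5; 6; 7; 8]
    [:: [:: 5; 8]; [:: 6; 7]; [:: 2; 3]; [:: 0; 1]]
    [:: [:: 0; 7; 8]; [:: 3; 5; 6]; [:: 1; 2]];
  Trade [:: 0; 1; 2; 3; 4; 6; 7; 8]
    [:: [:: 4; 8]; [:: 6; 7]; [:: 2; 3]; [:: 0; 1]]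
    [:: [:: 7; 8]; [:: 0; 3; 4; 6]; [:: 1; 2]];
  Trade [:: 2; 3; 4; 5; 6; 7; 8] [:: [:: 4; 5; 8]; [:: 6; 7]; [:: 2; 3]]
    [:: [:: 7; 8]; [:: 2; 5; 6]; [:: 3; 4]];
  Trade [:: 0; 1; 4; 5; 6; 7; 8] [:: [:: 4; 5; 8]; [:: 6; 7]; [:: 0; 1]]
    [:: [:: 1; 7; 8]; [:: 5; 6]; [:: 0; 4]];
  Trade [:: 0; 1; 2; 3; 4; 6; 7; 8]
    [:: [:: 4; 8]; [:: 6; 7]; [:: 2; 3]; [:: 0; 1]]
    [:: [:: 7; 8]; [:: 1; 2; 6]; [:: 0; 3; 4]]; Split 1 7; Split 0 7;
  Trade [:: 0; 1; 2; 3; 4; 7; 8] [:: [:: 4; 8]; [:: 0; 1; 7]; [:: 2; 3]]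
    [:: [:: 7; 8]; [:: 0; 3; 4]; [:: 1; 2]]; Split 1 6;
  Trade [:: 1; 2; 3; 4; 5; 6; 7; 8] [:: [:: 4; 5; 8]; [:: 1; 6; 7]; [:: 2; 3]]
    [:: [:: 7; 8]; [:: 5; 6]; [:: 3; 4]; [:: 1; 2]]; Split 1 5; Split 2 6;
  Split 2 8; Split 3 6;
  Trade [:: 0; 1; 2; 3; 4; 5; 6] [:: [:: 2; 3; 6]; [:: 4; 5]; [:: 0; 1]]
    [:: [:: 5; 6]; [:: 0; 3; 4]; [:: 1; 2]]; Split 4 7; Split 4 6;
  Trade [:: 0; 1; 2; 3; 4; 6; 7] [:: [:: 4; 6; 7]; [:: 2; 3]; [:: 0; 1]]
    [:: [:: 2; 7]; [:: 1; 6]; [:: 0; 3; 4]]; Split 0 6; Split 0 2;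
  Trade [:: 0; 1; 2; 4; 5; 6; 7; 8] [:: [:: 4; 5; 8]; [:: 1; 7]; [:: 0; 2; 6]]
    [:: [:: 7; 8]; [:: 5; 6]; [:: 0; 4]; [:: 1; 2]];
  Trade [:: 0; 2; 3; 4; 6; 7] [:: [:: 4; 7]; [:: 0; 6]; [:: 2; 3]]
    [:: [:: 0; 2; 7]; [:: 3; 4; 6]];
  Trade [:: 0; 1; 2; 3; 4; 6; 7; 8]
    [:: [:: 4; 8]; [:: 6; 7]; [:: 2; 3]; [:: 0; 1]]
    [:: [:: 7; 8]; [:: 0; 3; 4; 6]; [:: 1; 2]]; Split 1 8; Split 1 4;
  Trade [:: 1; 2; 3; 4; 5; 6; 7; 8] [:: [:: 1; 4; 5; 8]; [:: 6; 7]; [:: 2; 3]]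
    [:: [:: 7; 8]; [:: 5; 6]; [:: 3; 4]; [:: 1; 2]]; Split 0 8; Split 0 6;
  Split 0 2;
  Trade [:: 0; 1; 2; 4; 5; 6; 7] [:: [:: 1; 7]; [:: 0; 2; 6]; [:: 4; 5]]
    [:: [:: 0; 4; 7]; [:: 5; 6]; [:: 1; 2]]; Split 1 3; Split 2 4; Split 3 5;
  Trade [:: 0; 1; 2; 3; 4; 5; 6] [:: [:: 0; 6]; [:: 1; 3; 5]; [:: 2; 4]]
    [:: [:: 5; 6]; [:: 0; 3; 4]; [:: 1; 2]];
  Trade [:: 1; 2; 3; 5; 6; 7; 8] [:: [:: 1; 5; 8]; [:: 6; 7]; [:: 2; 3]]
    [:: [:: 7; 8]; [:: 3; 5; 6]; [:: 1; 2]];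
  Trade [:: 1; 2; 4; 5; 6; 7; 8] [:: [:: 4; 5; 8]; [:: 1; 7]; [:: 2; 6]]
    [:: [:: 7; 8]; [:: 5; 6]; [:: 1; 2; 4]];
  Trade [:: 0; 1; 2; 3; 6; 7] [:: [:: 1; 7]; [:: 0; 6]; [:: 2; 3]]
    [:: [:: 0; 2; 7]; [:: 1; 3; 6]];
  Trade [:: 0; 1; 2; 3; 6; 7; 8] [:: [:: 0; 1; 8]; [:: 6; 7]; [:: 2; 3]]
    [:: [:: 7; 8]; [:: 0; 3; 6]; [:: 1; 2]];
  Trade [:: 0; 1; 4; 5; 6; 7; 8] [:: [:: 4; 5; 8]; [:: 6; 7]; [:: 0; 1]]
    [:: [:: 0; 7; 8]; [:: 5; 6]; [:: 1; 4]];
  Trade [:: 0; 1; 4; 5; 6; 7; 8] [:: [:: 4; 5; 8]; [:: 6; 7]; [:: 0; 1]]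
    [:: [:: 1; 8]; [:: 0; 4; 7]; [:: 5; 6]];
  Trade [:: 2; 3; 4; 5; 6; 7; 8] [:: [:: 4; 5; 8]; [:: 6; 7]; [:: 2; 3]]
    [:: [:: 2; 7; 8]; [:: 5; 6]; [:: 3; 4]];
  Trade [:: 0; 1; 2; 3; 4; 6; 7; 8]
    [:: [:: 4; 8]; [:: 6; 7]; [:: 2; 3]; [:: 0; 1]]
    [:: [:: 7; 8]; [:: 1; 2; 6]; [:: 0; 3; 4]];
  Trade [:: 0; 1; 4; 5; 6; 7; 8] [:: [:: 4; 5; 8]; [:: 6; 7]; [:: 0; 1]]
    [:: [:: 7; 8]; [:: 1; 5; 6]; [:: 0; 4]];
  Trade [:: 0; 1; 2; 3; 4; 5; 6; 7]
    [:: [:: 6; 7]; [:: 4; 5]; [:: 2; 3]; [:: 0; 1]]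
    [:: [:: 1; 2; 7]; [:: 5; 6]; [:: 0; 3; 4]]; Split 1 7; Split 0 7;
  Trade [:: 0; 1; 2; 3; 4; 5; 7; 8; 9]
    [:: [:: 8; 9]; [:: 0; 1; 7]; [:: 4; 5]; [:: 2; 3]]
    [:: [:: 5; 9]; [:: 7; 8]; [:: 0; 3; 4]; [:: 1; 2]]; Split 1 6;
  Trade [:: 1; 2; 3; 4; 5; 6; 7; 8; 9]
    [:: [:: 8; 9]; [:: 1; 6; 7]; [:: 4; 5]; [:: 2; 3]]
    [:: [:: 5; 6; 9]; [:: 7; 8]; [:: 3; 4]; [:: 1; 2]]; Split 4 7; Split 4 6;
  Trade [:: 0; 1; 2; 3; 4; 6; 7; 8; 9]
    [:: [:: 8; 9]; [:: 4; 6; 7]; [:: 2; 3]; [:: 0; 1]]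
    [:: [:: 6; 9]; [:: 7; 8]; [:: 0; 3; 4]; [:: 1; 2]]; Split 5 7;
  Trade [:: 0; 1; 2; 3; 4; 5; 7; 8; 9]
    [:: [:: 8; 9]; [:: 4; 5; 7]; [:: 2; 3]; [:: 0; 1]]
    [:: [:: 5; 9]; [:: 7; 8]; [:: 0; 3; 4]; [:: 1; 2]]; Split 2 6; Split 2 7;
  Trade [:: 0; 1; 2; 4; 5; 6; 7; 8; 9]
    [:: [:: 8; 9]; [:: 2; 6; 7]; [:: 4; 5]; [:: 0; 1]]
    [:: [:: 5; 6; 9]; [:: 7; 8]; [:: 0; 4]; [:: 1; 2]]; Split 1 5; Split 0 5;
  Trade [:: 0; 1; 2; 3; 4; 5; 7] [:: [:: 4; 7]; [:: 0; 1; 5]; [:: 2; 3]]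
    [:: [:: 5; 7]; [:: 0; 3; 4]; [:: 1; 2]]; Split 1 4;
  Trade [:: 1; 2; 3; 4; 5; 6; 7; 8; 9]
    [:: [:: 8; 9]; [:: 6; 7]; [:: 1; 4; 5]; [:: 2; 3]]
    [:: [:: 5; 6; 9]; [:: 7; 8]; [:: 3; 4]; [:: 1; 2]];
  Trade [:: 0; 1; 4; 5; 6; 7] [:: [:: 6; 7]; [:: 4; 5]; [:: 0; 1]]
    [:: [:: 0; 5; 7]; [:: 1; 4; 6]];
  Trade [:: 0; 1; 2; 3; 4; 5; 6; 7]
    [:: [:: 6; 7]; [:: 4; 5]; [:: 2; 3]; [:: 0; 1]]
    [:: [:: 2; 7]; [:: 1; 5; 6]; [:: 0; 3; 4]];
  Trade [:: 0; 1; 2; 3; 4; 5; 6; 7]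
    [:: [:: 6; 7]; [:: 4; 5]; [:: 2; 3]; [:: 0; 1]]
    [:: [:: 5; 7]; [:: 1; 2; 6]; [:: 0; 3; 4]]; Split 0 9;
  Trade [:: 0; 4; 5; 6; 7; 9] [:: [:: 0; 9]; [:: 6; 7]; [:: 4; 5]]
    [:: [:: 5; 6; 9]; [:: 0; 4; 7]]; Split 1 5; Split 0 5;
  Trade [:: 0; 1; 2; 3; 5; 6; 7; 8; 9]
    [:: [:: 8; 9]; [:: 6; 7]; [:: 0; 1; 5]; [:: 2; 3]]
    [:: [:: 5; 6; 9]; [:: 7; 8]; [:: 0; 3]; [:: 1; 2]]; Split 1 4;
  Trade [:: 1; 2; 3; 4; 5; 6; 7; 8; 9]
    [:: [:: 8; 9]; [:: 6; 7]; [:: 1; 4; 5]; [:: 2; 3]]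
    [:: [:: 5; 6; 9]; [:: 7; 8]; [:: 3; 4]; [:: 1; 2]]; Split 0 8; Split 1 8;
  Trade [:: 0; 1; 2; 3; 4; 5; 6; 7; 8]
    [:: [:: 0; 1; 8]; [:: 6; 7]; [:: 4; 5]; [:: 2; 3]]
    [:: [:: 7; 8]; [:: 5; 6]; [:: 0; 3; 4]; [:: 1; 2]];
  Trade [:: 0; 1; 4; 5; 6; 7; 8; 9]
    [:: [:: 8; 9]; [:: 6; 7]; [:: 4; 5]; [:: 0; 1]]
    [:: [:: 5; 6; 9]; [:: 1; 8]; [:: 0; 4; 7]];
  Trade [:: 0; 1; 4; 5; 6; 7; 8; 9]
    [:: [:: 8; 9]; [:: 6; 7]; [:: 4; 5]; [:: 0; 1]]
    [:: [:: 5; 6; 9]; [:: 0; 7; 8]; [:: 1; 4]];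
  Trade [:: 0; 1; 4; 5; 6; 7] [:: [:: 6; 7]; [:: 4; 5]; [:: 0; 1]]
    [:: [:: 0; 4; 7]; [:: 1; 5; 6]]; Split 1 8; Split 0 8;
  Trade [:: 0; 1; 2; 3; 4; 5; 6; 7; 8]
    [:: [:: 0; 1; 8]; [:: 6; 7]; [:: 4; 5]; [:: 2; 3]]
    [:: [:: 7; 8]; [:: 5; 6]; [:: 0; 3; 4]; [:: 1; 2]]; Split 2 7; Split 2 6;
  Trade [:: 0; 1; 2; 4; 5; 6; 7; 8; 9]
    [:: [:: 8; 9]; [:: 2; 6; 7]; [:: 4; 5]; [:: 0; 1]]
    [:: [:: 5; 6; 9]; [:: 7; 8]; [:: 0; 4]; [:: 1; 2]]; Split 2 5; Split 0 7;
  Split 0 6;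
  Trade [:: 0; 4; 5; 6; 7; 8; 9] [:: [:: 8; 9]; [:: 0; 6; 7]; [:: 4; 5]]
    [:: [:: 5; 6; 9]; [:: 7; 8]; [:: 0; 4]]; Split 2 4;
  Trade [:: 0; 1; 2; 4; 5; 6; 7; 8; 9]
    [:: [:: 8; 9]; [:: 6; 7]; [:: 2; 4; 5]; [:: 0; 1]]
    [:: [:: 5; 6; 9]; [:: 7; 8]; [:: 0; 4]; [:: 1; 2]]; Split 3 5;
  Trade [:: 0; 1; 2; 3; 5; 6; 7; 8; 9]
    [:: [:: 8; 9]; [:: 6; 7]; [:: 2; 3; 5]; [:: 0; 1]]
    [:: [:: 5; 6; 9]; [:: 7; 8]; [:: 0; 3]; [:: 1; 2]]; Split 3 6;
  Trade [:: 0; 3; 4; 5; 6; 7; 8; 9]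
    [:: [:: 8; 9]; [:: 0; 7]; [:: 3; 6]; [:: 4; 5]]
    [:: [:: 5; 6; 9]; [:: 7; 8]; [:: 0; 3; 4]]; Split 0 2; Split 0 5;
  Split 1 4;
  Trade [:: 0; 1; 2; 4; 5; 6; 7; 8; 9]
    [:: [:: 8; 9]; [:: 6; 7]; [:: 0; 2; 5]; [:: 1; 4]]
    [:: [:: 5; 6; 9]; [:: 0; 8]; [:: 1; 7]; [:: 2; 4]];
  Trade [:: 1; 2; 3; 4; 5; 6; 7; 8]
    [:: [:: 1; 8]; [:: 6; 7]; [:: 4; 5]; [:: 2; 3]]
    [:: [:: 7; 8]; [:: 3; 5; 6]; [:: 1; 2; 4]];
  Trade [:: 0; 1; 2; 3; 4; 5; 6; 7]
    [:: [:: 6; 7]; [:: 4; 5]; [:: 2; 3]; [:: 0; 1]]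
    [:: [:: 1; 7]; [:: 0; 3; 5; 6]; [:: 2; 4]];
  Trade [:: 0; 1; 2; 3; 4; 5; 6; 7]
    [:: [:: 6; 7]; [:: 4; 5]; [:: 2; 3]; [:: 0; 1]]
    [:: [:: 1; 7]; [:: 3; 5; 6]; [:: 0; 2; 4]];
  Trade [:: 0; 1; 2; 5; 6; 7; 8; 9]
    [:: [:: 8; 9]; [:: 6; 7]; [:: 2; 5]; [:: 0; 1]]
    [:: [:: 5; 6; 9]; [:: 0; 7; 8]; [:: 1; 2]];
  Trade [:: 0; 1; 2; 3; 4; 5; 6; 7]
    [:: [:: 6; 7]; [:: 4; 5]; [:: 2; 3]; [:: 0; 1]]
    [:: [:: 1; 7]; [:: 2; 5; 6]; [:: 0; 3; 4]];
  Trade [:: 0; 1; 2; 3; 4; 5; 6; 7]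
    [:: [:: 6; 7]; [:: 4; 5]; [:: 2; 3]; [:: 0; 1]]
    [:: [:: 1; 2; 7]; [:: 5; 6]; [:: 0; 3; 4]];
  Trade [:: 0; 1; 4; 5; 6; 7; 8; 9]
    [:: [:: 8; 9]; [:: 6; 7]; [:: 4; 5]; [:: 0; 1]]
    [:: [:: 5; 6; 9]; [:: 1; 7; 8]; [:: 0; 4]]; Split 2 9; Split 2 8;
  Trade [:: 0; 1; 2; 4; 5; 6; 7; 8; 9; 10]
    [:: [:: 6; 7; 10]; [:: 2; 8; 9]; [:: 4; 5]; [:: 0; 1]]
    [:: [:: 9; 10]; [:: 7; 8]; [:: 5; 6]; [:: 0; 4]; [:: 1; 2]]; Split 1 8;
  Split 0 8;
  Trade [:: 0; 1; 2; 3; 4; 5; 6; 7; 8]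
    [:: [:: 0; 1; 8]; [:: 6; 7]; [:: 4; 5]; [:: 2; 3]]
    [:: [:: 7; 8]; [:: 5; 6]; [:: 0; 3; 4]; [:: 1; 2]]; Split 1 9;
  Trade [:: 1; 2; 3; 4; 5; 6; 7; 8; 9; 10]
    [:: [:: 6; 7; 10]; [:: 1; 8; 9]; [:: 4; 5]; [:: 2; 3]]
    [:: [:: 9; 10]; [:: 7; 8]; [:: 5; 6]; [:: 3; 4]; [:: 1; 2]]; Split 3 9;
  Trade [:: 0; 1; 2; 3; 4; 5; 6; 9; 10]
    [:: [:: 6; 10]; [:: 2; 3; 9]; [:: 4; 5]; [:: 0; 1]]
    [:: [:: 9; 10]; [:: 5; 6]; [:: 0; 3; 4]; [:: 1; 2]]; Split 3 10;
  Split 3 6;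
  Trade [:: 0; 1; 2; 3; 4; 5; 6; 9; 10]
    [:: [:: 3; 6; 10]; [:: 2; 9]; [:: 4; 5]; [:: 0; 1]]
    [:: [:: 9; 10]; [:: 5; 6]; [:: 0; 3; 4]; [:: 1; 2]]; Split 0 6; Split 0 7;
  Trade [:: 0; 1; 2; 3; 4; 5; 6; 7; 8]
    [:: [:: 1; 8]; [:: 0; 6; 7]; [:: 4; 5]; [:: 2; 3]]
    [:: [:: 7; 8]; [:: 5; 6]; [:: 0; 3; 4]; [:: 1; 2]];
  Trade [:: 0; 1; 2; 3; 6; 7; 8; 9; 10]
    [:: [:: 6; 7; 10]; [:: 8; 9]; [:: 2; 3]; [:: 0; 1]]
    [:: [:: 9; 10]; [:: 0; 7; 8]; [:: 3; 6]; [:: 1; 2]];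
  Trade [:: 0; 1; 2; 3; 6; 7; 8; 9; 10]
    [:: [:: 6; 7; 10]; [:: 8; 9]; [:: 2; 3]; [:: 0; 1]]
    [:: [:: 9; 10]; [:: 7; 8]; [:: 0; 3; 6]; [:: 1; 2]]; Split 0 6; Split 0 7;
  Trade [:: 0; 1; 2; 3; 4; 5; 6; 7; 8]
    [:: [:: 1; 8]; [:: 0; 6; 7]; [:: 4; 5]; [:: 2; 3]]
    [:: [:: 7; 8]; [:: 5; 6]; [:: 0; 3; 4]; [:: 1; 2]];
  Trade [:: 0; 1; 2; 3; 7; 8; 9; 10]
    [:: [:: 7; 10]; [:: 8; 9]; [:: 2; 3]; [:: 0; 1]]
    [:: [:: 3; 9; 10]; [:: 0; 7; 8]; [:: 1; 2]];
  Trade [:: 0; 1; 2; 3; 6; 7; 8; 9; 10]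
    [:: [:: 6; 7; 10]; [:: 8; 9]; [:: 2; 3]; [:: 0; 1]]
    [:: [:: 3; 9; 10]; [:: 7; 8]; [:: 0; 6]; [:: 1; 2]];
  Trade [:: 0; 1; 2; 3; 4; 5; 6; 8; 9; 10]
    [:: [:: 6; 10]; [:: 8; 9]; [:: 4; 5]; [:: 2; 3]; [:: 0; 1]]
    [:: [:: 9; 10]; [:: 1; 2; 8]; [:: 5; 6]; [:: 0; 3; 4]]; Split 1 9;
  Split 0 9;
  Trade [:: 0; 1; 2; 3; 4; 5; 6; 9; 10]
    [:: [:: 6; 10]; [:: 0; 1; 9]; [:: 4; 5]; [:: 2; 3]]
    [:: [:: 9; 10]; [:: 5; 6]; [:: 0; 3; 4]; [:: 1; 2]]; Split 1 8;
  Trade [:: 1; 2; 3; 4; 5; 6; 7; 8; 9; 10]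
    [:: [:: 6; 7; 10]; [:: 1; 8; 9]; [:: 4; 5]; [:: 2; 3]]
    [:: [:: 9; 10]; [:: 7; 8]; [:: 5; 6]; [:: 3; 4]; [:: 1; 2]]; Split 2 8;
  Split 3 8;
  Trade [:: 0; 1; 2; 3; 4; 5; 6; 7; 8]
    [:: [:: 2; 3; 8]; [:: 6; 7]; [:: 4; 5]; [:: 0; 1]]
    [:: [:: 7; 8]; [:: 5; 6]; [:: 0; 3; 4]; [:: 1; 2]]; Split 3 7; Split 3 6;
  Trade [:: 0; 1; 2; 3; 4; 5; 6; 7; 8]
    [:: [:: 2; 8]; [:: 3; 6; 7]; [:: 4; 5]; [:: 0; 1]]
    [:: [:: 7; 8]; [:: 5; 6]; [:: 0; 3; 4]; [:: 1; 2]]; Split 0 6; Split 0 7;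
  Trade [:: 0; 2; 3; 4; 5; 6; 7; 8; 9]
    [:: [:: 8; 9]; [:: 0; 6; 7]; [:: 4; 5]; [:: 2; 3]]
    [:: [:: 2; 9]; [:: 7; 8]; [:: 5; 6]; [:: 0; 3; 4]]; Split 0 8; Split 0 10;
  Trade [:: 0; 1; 2; 3; 4; 5; 6; 9; 10]
    [:: [:: 0; 6; 10]; [:: 1; 9]; [:: 4; 5]; [:: 2; 3]]
    [:: [:: 9; 10]; [:: 5; 6]; [:: 0; 3; 4]; [:: 1; 2]];
  Trade [:: 0; 1; 2; 3; 6; 7; 8; 9; 10]
    [:: [:: 6; 7; 10]; [:: 1; 9]; [:: 0; 8]; [:: 2; 3]]
    [:: [:: 0; 9; 10]; [:: 7; 8]; [:: 3; 6]; [:: 1; 2]];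
  Trade [:: 0; 1; 2; 3; 6; 7; 8; 9; 10]
    [:: [:: 6; 7; 10]; [:: 8; 9]; [:: 2; 3]; [:: 0; 1]]
    [:: [:: 9; 10]; [:: 0; 7; 8]; [:: 3; 6]; [:: 1; 2]];
  Trade [:: 0; 1; 2; 3; 6; 7; 8; 9; 10]
    [:: [:: 6; 7; 10]; [:: 8; 9]; [:: 2; 3]; [:: 0; 1]]
    [:: [:: 9; 10]; [:: 7; 8]; [:: 0; 3; 6]; [:: 1; 2]]; Split 0 6; Split 0 7;
  Trade [:: 0; 2; 3; 4; 5; 6; 7; 8; 9]
    [:: [:: 8; 9]; [:: 0; 6; 7]; [:: 4; 5]; [:: 2; 3]]
    [:: [:: 2; 9]; [:: 7; 8]; [:: 5; 6]; [:: 0; 3; 4]]; Split 0 8; Split 0 10;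
  Trade [:: 0; 1; 2; 3; 4; 5; 6; 9; 10]
    [:: [:: 0; 6; 10]; [:: 1; 9]; [:: 4; 5]; [:: 2; 3]]
    [:: [:: 9; 10]; [:: 5; 6]; [:: 0; 3; 4]; [:: 1; 2]];
  Trade [:: 0; 1; 2; 3; 7; 8; 9; 10]
    [:: [:: 7; 10]; [:: 1; 9]; [:: 0; 8]; [:: 2; 3]]
    [:: [:: 0; 9; 10]; [:: 3; 7; 8]; [:: 1; 2]];
  Trade [:: 0; 1; 2; 3; 7; 8; 9; 10]
    [:: [:: 7; 10]; [:: 8; 9]; [:: 2; 3]; [:: 0; 1]]
    [:: [:: 9; 10]; [:: 0; 3; 7; 8]; [:: 1; 2]];
  Trade [:: 0; 1; 2; 3; 6; 7; 8; 9; 10]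
    [:: [:: 6; 7; 10]; [:: 8; 9]; [:: 2; 3]; [:: 0; 1]]
    [:: [:: 9; 10]; [:: 3; 7; 8]; [:: 0; 6]; [:: 1; 2]];
  Trade [:: 0; 1; 2; 3; 4; 5; 6; 8; 9; 10]
    [:: [:: 6; 10]; [:: 8; 9]; [:: 4; 5]; [:: 2; 3]; [:: 0; 1]]
    [:: [:: 9; 10]; [:: 1; 2; 8]; [:: 5; 6]; [:: 0; 3; 4]];
  Trade [:: 0; 1; 2; 3; 4; 5; 6; 7; 8; 9]
    [:: [:: 8; 9]; [:: 6; 7]; [:: 4; 5]; [:: 2; 3]; [:: 0; 1]]
    [:: [:: 1; 2; 9]; [:: 7; 8]; [:: 5; 6]; [:: 0; 3; 4]]].

Lemma patterns_refuted : all_refuted false patterns.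
Proof. by apply: (@run_refuted _ [::] pattern_script) I _; vm_compute. Qed.

(** The search tree in preorder: after a [Grow] come the filled child if present, the fresh label,
    then the old labels. The number in [Use] is a position in [patterns]. *)
Definition growth_script : seq instr := [::
  Grow false 0; Grow false 0; Grow true 0; Grow false 1; Grow false 1;
  Grow true 3; Grow true 3; Grow false 5; Grow false 5; Grow true 6;
  Grow true 6; Grow true 4; Grow false 7; Grow false 7;
  Use 0 false [:: 0; 3; 5; 6; 7; 9]; Grow false 7; Grow true 4; Grow false 2;
  Grow false 2; Grow true 11; Grow true 11;
  Use 3 false [:: 0; 1; 2; 3; 4; 11; 5; 8; 12]; Grow true 11;
  Use 3 false [:: 0; 1; 2; 3; 4; 11; 5; 8; 12]; Grow false 2; Grow true 9;
  Use 3 false [:: 0; 1; 2; 3; 4; 11; 5; 8; 9]; Grow false 2; Grow true 10;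
  Use 3 false [:: 0; 1; 2; 3; 4; 11; 5; 8; 10]; Grow false 7;
  Use 0 false [:: 0; 3; 5; 6; 7; 9]; Grow false 7; Grow false 7;
  Use 0 false [:: 0; 3; 5; 6; 7; 9]; Grow false 2; Grow true 4;
  Use 4 true [:: 1; 4; 8; 2; 0; 3; 5; 6]; Grow false 7;
  Use 0 false [:: 0; 3; 5; 6; 7; 9]; Grow false 7;
  Use 0 false [:: 0; 3; 5; 6; 7; 8]; Grow false 7; Grow true 4; Grow false 2;
  Grow false 2; Grow true 10; Grow true 10;
  Use 3 false [:: 0; 1; 2; 3; 4; 10; 5; 8; 11]; Grow false 2; Grow true 9;
  Use 3 false [:: 0; 1; 2; 3; 4; 10; 5; 8; 9]; Grow true 6; Grow false 2;
  Grow false 2; Grow true 4; Grow true 4; Grow true 9; Grow true 9;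
  Use 3 false [:: 0; 1; 2; 3; 4; 9; 5; 10; 11]; Grow true 9;
  Use 3 false [:: 0; 1; 2; 3; 4; 9; 5; 10; 11]; Grow true 9;
  Use 3 false [:: 0; 1; 2; 3; 4; 9; 5; 10; 11]; Grow true 9;
  Use 3 false [:: 0; 1; 2; 3; 4; 9; 5; 10; 11]; Grow true 4; Grow true 9;
  Grow true 9; Use 3 false [:: 0; 1; 2; 3; 4; 9; 5; 10; 11]; Grow true 9;
  Use 3 false [:: 0; 1; 2; 3; 4; 9; 5; 10; 11]; Grow true 4; Grow true 9;
  Grow true 9; Use 3 false [:: 0; 1; 2; 3; 4; 9; 5; 10; 11]; Grow true 9;
  Use 3 false [:: 0; 1; 2; 3; 4; 9; 5; 10; 11]; Grow false 2; Grow true 4;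
  Use 4 true [:: 1; 4; 9; 2; 0; 3; 5; 6]; Grow false 2; Grow true 6;
  Use 2 false [:: 0; 3; 5; 6; 2; 8; 1; 7]; Grow true 6; Grow false 2;
  Use 0 false [:: 0; 3; 5; 6; 7; 2]; Grow false 2;
  Use 1 false [:: 0; 3; 5; 6; 7; 2; 1; 8]; Grow false 2;
  Use 1 false [:: 0; 3; 5; 6; 7; 2; 1; 8]; Grow false 2; Grow true 6;
  Use 2 false [:: 0; 3; 5; 6; 2; 7; 1; 8]; Grow true 4; Grow false 5;
  Grow true 4; Grow false 2; Grow false 2; Grow true 9; Grow true 9;
  Use 3 false [:: 0; 1; 2; 3; 4; 9; 5; 8; 10]; Grow true 9;
  Use 3 false [:: 0; 1; 2; 3; 4; 9; 5; 8; 10]; Grow false 2; Grow true 6;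
  Use 3 false [:: 0; 1; 2; 3; 4; 9; 5; 8; 6]; Grow false 2; Grow true 7;
  Use 3 false [:: 0; 1; 2; 3; 4; 9; 5; 8; 7]; Grow false 2; Grow false 5;
  Grow true 4; Grow true 6; Grow false 9; Grow false 9; Grow true 6;
  Grow true 7; Grow true 7; Grow false 11; Grow false 11;
  Use 3 true [:: 5; 6; 7; 3; 9; 11; 0; 10; 12]; Grow false 11;
  Use 3 true [:: 5; 6; 7; 3; 9; 11; 0; 10; 12]; Grow false 9; Grow true 6;
  Grow true 7; Use 7 false [:: 6; 9; 10; 7; 5; 3; 0; 1; 4; 8; 2];
  Grow false 5; Grow true 4; Grow false 2; Grow false 2; Grow true 8;
  Grow true 8; Use 3 false [:: 0; 1; 2; 3; 4; 8; 5; 7; 9]; Grow false 2;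
  Grow true 6; Use 3 false [:: 0; 1; 2; 3; 4; 8; 5; 7; 6]; Grow false 5;
  Grow true 4; Use 0 false [:: 0; 3; 5; 6; 4; 1]; Grow true 4;
  Use 2 false [:: 0; 3; 5; 6; 1; 4; 2; 7]; Grow true 4;
  Use 2 false [:: 0; 3; 5; 6; 1; 4; 2; 7]; Grow false 5; Grow true 4;
  Grow false 2; Grow false 2; Grow true 8; Grow true 8;
  Use 3 false [:: 0; 1; 2; 3; 4; 8; 5; 6; 9]; Grow false 2; Grow true 7;
  Use 3 false [:: 0; 1; 2; 3; 4; 8; 5; 6; 7]; Grow true 3; Grow false 5;
  Grow false 5; Grow true 4; Grow true 4; Grow false 8; Grow false 8;
  Grow true 9; Grow true 9; Grow false 10; Grow false 10;
  Use 0 false [:: 1; 4; 8; 9; 10; 11]; Grow false 10;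
  Use 0 false [:: 1; 4; 8; 9; 10; 11]; Grow false 2; Grow true 9;
  Use 0 false [:: 1; 4; 8; 9; 10; 2]; Grow false 6; Grow true 9;
  Use 0 false [:: 1; 4; 8; 9; 10; 6]; Grow false 8; Grow true 7;
  Use 0 false [:: 1; 4; 8; 9; 7; 5]; Grow false 2; Grow true 4; Grow true 7;
  Grow false 9; Grow false 9; Grow true 7; Grow true 10; Grow false 11;
  Grow false 11; Grow true 10; Use 0 false [:: 5; 7; 9; 10; 11; 12];
  Grow false 6; Grow true 10; Use 0 false [:: 5; 7; 9; 10; 11; 6];
  Grow false 6; Grow true 7; Use 6 true [:: 1; 4; 8; 2; 0; 3; 5; 7; 9; 6];
  Grow false 6; Grow true 4; Use 2 false [:: 1; 4; 8; 6; 0; 3; 2; 5];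
  Grow false 5; Grow true 4; Use 2 false [:: 1; 4; 7; 5; 0; 3; 2; 6];
  Grow true 3; Grow false 2; Grow true 4; Grow false 7; Grow false 7;
  Grow true 4; Grow true 8; Grow false 9; Grow false 9; Grow true 8;
  Use 0 false [:: 1; 4; 7; 8; 9; 10]; Grow false 5; Grow true 8;
  Use 0 false [:: 1; 4; 7; 8; 9; 5]; Grow false 5; Grow true 4;
  Use 2 false [:: 1; 4; 7; 5; 0; 3; 2; 6]; Grow true 3; Grow false 2;
  Grow true 4; Grow true 4; Grow false 6; Grow false 6;
  Use 4 true [:: 0; 3; 5; 2; 1; 4; 6; 7]; Grow false 6; Grow true 7;
  Grow false 9; Grow false 9; Grow true 7; Grow true 8; Grow true 8;
  Grow false 11; Grow false 11; Use 3 true [:: 6; 7; 8; 4; 9; 11; 1; 10; 12];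
  Grow false 11; Use 3 true [:: 6; 7; 8; 4; 9; 11; 1; 10; 12]; Grow false 9;
  Grow true 7; Grow true 8; Use 7 false [:: 7; 9; 10; 8; 6; 4; 1; 0; 3; 5; 2];
  Grow false 6; Grow false 6; Grow true 4; Grow true 8; Grow false 9;
  Grow false 9; Grow true 8; Grow true 10; Grow false 11; Grow false 11;
  Grow true 10; Use 0 false [:: 6; 8; 9; 10; 11; 12]; Grow false 7;
  Grow true 10; Use 0 false [:: 6; 8; 9; 10; 11; 7]; Grow false 7;
  Grow true 8; Use 6 true [:: 0; 3; 5; 2; 1; 4; 6; 8; 9; 7]; Grow false 2;
  Grow true 4; Grow true 4; Grow false 7; Grow false 7; Grow true 8;
  Grow true 8; Grow false 9; Grow false 9; Use 0 false [:: 1; 4; 7; 8; 9; 10];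
  Grow false 9; Use 0 false [:: 1; 4; 7; 8; 9; 10]; Grow false 7; Grow true 6;
  Use 1 false [:: 1; 4; 7; 8; 6; 2; 0; 5]; Grow false 2; Grow true 4;
  Bad [:: 0; 1; 2; 3; 4; 5; 6] [:: [:: 4; 6]; [:: 3; 5]; [:: 0; 1; 2]]
    [:: [:: 2; 5; 6]; [:: 1; 4]; [:: 0; 3]]; Grow true 3; Grow false 2;
  Grow true 4; Grow false 7; Grow false 7; Grow true 4; Grow true 8;
  Grow false 9; Grow false 9; Grow true 8; Use 0 false [:: 1; 4; 7; 8; 9; 10];
  Grow false 6; Grow true 8; Use 0 false [:: 1; 4; 7; 8; 9; 6]; Grow false 6;
  Grow true 4; Use 2 false [:: 1; 4; 7; 6; 0; 3; 2; 5]; Grow false 1;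
  Grow true 3; Grow true 3; Grow false 6; Grow false 6; Grow true 7;
  Grow true 7; Grow false 8; Grow false 8; Use 0 false [:: 0; 3; 6; 7; 8; 9];
  Grow false 8; Use 0 false [:: 0; 3; 6; 7; 8; 9]; Grow false 8;
  Use 0 false [:: 0; 3; 6; 7; 8; 9]; Grow false 2; Grow true 7;
  Use 0 false [:: 0; 3; 6; 7; 8; 2]; Grow false 6; Grow true 4;
  Use 1 false [:: 0; 3; 6; 7; 4; 1; 2; 5]; Grow false 6; Grow true 5;
  Use 1 false [:: 0; 3; 6; 7; 5; 1; 2; 4]; Grow false 2; Grow true 3;
  Grow true 4; Grow true 4; Grow false 7; Grow false 7; Grow true 8;
  Grow true 8; Grow false 9; Grow false 9; Grow true 10; Grow true 10;
  Use 0 true [:: 4; 7; 8; 9; 10; 11]; Grow false 9; Grow true 5;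
  Use 0 true [:: 4; 7; 8; 9; 10; 5]; Grow false 7; Grow true 5;
  Use 5 false [:: 4; 7; 8; 5; 1; 0; 3; 6; 2]; Grow false 1; Grow true 3;
  Grow false 2; Grow false 2; Grow true 6; Grow true 6; Grow false 7;
  Grow false 7; Grow true 8; Grow true 8; Grow false 9; Grow false 9;
  Use 0 false [:: 2; 6; 7; 8; 9; 10]; Grow false 9;
  Use 0 false [:: 2; 6; 7; 8; 9; 10]; Grow false 7; Grow true 4;
  Use 1 false [:: 2; 6; 7; 8; 4; 1; 0; 5]; Grow false 2; Grow true 4;
  Bad [:: 0; 1; 2; 3; 4; 5; 6] [:: [:: 4; 6]; [:: 3; 5]; [:: 0; 1; 2]]
    [:: [:: 2; 6]; [:: 1; 4; 5]; [:: 0; 3]]; Grow false 1; Grow true 3;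
  Grow false 2; Grow false 2; Grow true 5; Grow true 5; Grow false 6;
  Grow false 6; Use 4 true [:: 0; 3; 4; 1; 2; 5; 6; 7]; Grow false 6;
  Grow true 7; Grow false 9; Grow false 9; Grow true 7; Grow true 8;
  Grow true 8; Grow false 11; Grow false 11;
  Use 3 true [:: 6; 7; 8; 5; 9; 11; 2; 10; 12]; Grow false 11;
  Use 3 true [:: 6; 7; 8; 5; 9; 11; 2; 10; 12]; Grow false 9; Grow true 7;
  Grow true 8; Use 7 false [:: 7; 9; 10; 8; 6; 5; 2; 0; 3; 4; 1];
  Grow false 6; Grow false 6; Grow true 5; Grow true 8; Grow false 9;
  Grow false 9; Grow true 8; Grow true 10; Grow false 11; Grow false 11;
  Grow true 10; Use 0 false [:: 6; 8; 9; 10; 11; 12]; Grow false 7;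
  Grow true 10; Use 0 false [:: 6; 8; 9; 10; 11; 7]; Grow false 7;
  Grow true 8; Use 6 true [:: 0; 3; 4; 1; 2; 5; 6; 8; 9; 7]; Grow false 2;
  Grow true 5; Grow true 5; Grow false 7; Grow false 7; Grow true 8;
  Grow true 8; Grow false 9; Grow false 9; Grow true 10; Grow true 10;
  Use 0 true [:: 5; 7; 8; 9; 10; 11]; Grow false 9; Grow true 6;
  Use 0 true [:: 5; 7; 8; 9; 10; 6]; Grow false 7; Grow true 6;
  Use 5 false [:: 5; 7; 8; 6; 2; 0; 3; 4; 1]; Grow false 2; Grow false 2;
  Grow true 3; Grow true 6; Grow false 7; Grow false 7; Grow true 6;
  Grow true 8; Grow false 9; Grow false 9; Grow true 8;
  Use 0 false [:: 2; 6; 7; 8; 9; 10]; Grow false 5; Grow true 8;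
  Use 0 false [:: 2; 6; 7; 8; 9; 5]; Grow false 5; Grow true 6;
  Use 2 false [:: 2; 6; 7; 5; 0; 3; 1; 4]; Grow false 2; Grow true 3;
  Bad [:: 0; 1; 2; 3; 4; 5] [:: [:: 3; 4; 5]; [:: 0; 1; 2]]
    [:: [:: 2; 5]; [:: 1; 4]; [:: 0; 3]]; Grow false 1; Grow true 3;
  Grow false 2; Grow false 2; Grow true 6; Grow true 6; Grow false 7;
  Grow false 7; Grow true 8; Grow true 8; Grow false 9; Grow false 9;
  Use 0 false [:: 2; 6; 7; 8; 9; 10]; Grow false 9;
  Use 0 false [:: 2; 6; 7; 8; 9; 10]; Grow false 7; Grow true 5;
  Use 1 false [:: 2; 6; 7; 8; 5; 1; 0; 4]; Grow false 2; Grow true 5;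
  Bad [:: 0; 1; 2; 3; 4; 5; 6] [:: [:: 5; 6]; [:: 3; 4]; [:: 0; 1; 2]]
    [:: [:: 2; 6]; [:: 1; 4; 5]; [:: 0; 3]]; Grow true 0; Grow false 4;
  Grow false 4; Grow true 3; Grow true 3; Grow false 6; Grow false 6;
  Grow true 7; Grow true 7; Grow false 8; Grow false 8;
  Use 0 false [:: 0; 3; 6; 7; 8; 9]; Grow false 8;
  Use 0 false [:: 0; 3; 6; 7; 8; 9]; Grow false 1; Grow true 7;
  Use 0 false [:: 0; 3; 6; 7; 8; 1]; Grow false 2; Grow true 7;
  Use 0 false [:: 0; 3; 6; 7; 8; 2]; Grow false 6; Grow true 5;
  Use 0 false [:: 0; 3; 6; 7; 5; 4]; Grow false 1; Grow true 3; Grow true 5;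
  Grow false 7; Grow false 7; Grow true 5; Grow true 8; Grow false 9;
  Grow false 9; Grow true 8; Use 0 false [:: 4; 5; 7; 8; 9; 10]; Grow false 2;
  Grow true 8; Use 0 false [:: 2; 9; 8; 7; 5; 4]; Grow false 2; Grow true 5;
  Bad [:: 0; 1; 2; 3; 4; 5; 6; 7] [:: [:: 5; 7]; [:: 3; 6]; [:: 0; 1; 2; 4]]
    [:: [:: 2; 7]; [:: 1; 6]; [:: 4; 5]; [:: 0; 3]]; Grow false 2;
  Grow true 3; Grow true 5; Grow false 7; Grow false 7; Grow true 5;
  Grow true 8; Grow false 9; Grow false 9; Grow true 8;
  Use 0 false [:: 4; 5; 7; 8; 9; 10]; Grow false 1; Grow true 8;
  Use 0 false [:: 1; 9; 8; 7; 5; 4]; Grow false 1; Grow true 5;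
  Bad [:: 0; 1; 2; 3; 4; 5; 6; 7] [:: [:: 5; 7]; [:: 3; 6]; [:: 0; 1; 2; 4]]
    [:: [:: 1; 7]; [:: 2; 6]; [:: 4; 5]; [:: 0; 3]]; Grow false 1;
  Grow false 1; Grow false 4; Grow true 3; Grow true 6; Grow false 7;
  Grow false 7; Grow true 6; Grow true 8; Grow false 9; Grow false 9;
  Grow true 8; Use 0 false [:: 1; 6; 7; 8; 9; 10]; Grow false 2; Grow true 8;
  Use 0 false [:: 1; 6; 7; 8; 9; 2]; Grow false 2; Grow true 6;
  Bad [:: 0; 1; 2; 3; 4; 5; 6; 7] [:: [:: 6; 7]; [:: 3; 5]; [:: 0; 1; 2; 4]]
    [:: [:: 2; 7]; [:: 1; 6]; [:: 4; 5]; [:: 0; 3]]; Grow false 0;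
  Grow true 0; Grow false 1; Grow false 1; Grow true 5; Grow true 5;
  Grow false 6; Grow false 6; Grow true 7; Grow true 7; Grow false 8;
  Grow false 8; Use 0 false [:: 1; 5; 6; 7; 8; 9]; Grow false 8;
  Use 0 false [:: 1; 5; 6; 7; 8; 9]; Grow false 8;
  Use 0 false [:: 1; 5; 6; 7; 8; 9]; Grow false 2; Grow true 7;
  Use 0 false [:: 1; 5; 6; 7; 8; 2]; Grow false 6; Grow true 3;
  Use 1 false [:: 1; 5; 6; 7; 3; 0; 2; 4]; Grow false 6; Grow true 4;
  Use 1 false [:: 1; 5; 6; 7; 4; 0; 2; 3]; Grow false 2; Grow true 3;
  Grow true 3; Grow true 5; Grow false 7; Grow false 7; Grow true 8;
  Grow true 8; Grow false 9; Grow false 9; Grow true 10; Grow true 10;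
  Use 0 true [:: 3; 7; 8; 9; 10; 11]; Grow false 9; Grow true 4;
  Use 0 true [:: 3; 7; 8; 9; 10; 4]; Grow false 7; Grow true 4;
  Use 5 false [:: 3; 7; 8; 4; 0; 1; 5; 6; 2]; Grow false 1; Grow true 3;
  Grow false 2; Grow false 2; Grow true 6; Grow true 6; Grow false 7;
  Grow false 7; Grow true 8; Grow true 8; Grow false 9; Grow false 9;
  Use 0 false [:: 2; 6; 7; 8; 9; 10]; Grow false 9;
  Use 0 false [:: 2; 6; 7; 8; 9; 10]; Grow false 7; Grow true 4;
  Use 1 false [:: 2; 6; 7; 8; 4; 0; 1; 3]; Grow false 2; Grow true 4;
  Bad [:: 0; 1; 2; 3; 4; 5; 6] [:: [:: 4; 6]; [:: 3; 5]; [:: 0; 1; 2]]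
    [:: [:: 2; 6]; [:: 1; 5]; [:: 0; 3; 4]]; Grow false 1; Grow true 4;
  Grow false 2; Grow false 2; Grow true 6; Grow true 6; Grow false 7;
  Grow false 7; Grow true 8; Grow true 8; Grow false 9; Grow false 9;
  Use 0 false [:: 2; 6; 7; 8; 9; 10]; Grow false 9;
  Use 0 false [:: 2; 6; 7; 8; 9; 10]; Grow false 7; Grow true 3;
  Use 1 false [:: 2; 6; 7; 8; 3; 0; 1; 4]; Grow false 2; Grow true 3;
  Bad [:: 0; 1; 2; 3; 4; 5; 6] [:: [:: 3; 6]; [:: 4; 5]; [:: 0; 1; 2]]
    [:: [:: 2; 6]; [:: 1; 5]; [:: 0; 3; 4]]].

(** Three members of a heavy clique; it is not filled, as it may have a fourth member. *)
Definition seed := pattern 3 [:: 0; 0; 0] [:: 0; 1; 2] [::] [::].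

Lemma seed_refuted : refuted true seed.
Proof.
suff [] : all_refuted true [:: seed] by [].
by apply: run_refuted patterns_refuted (_ : run _ _ growth_script _); vm_compute.
Qed.

Lemma no_critical (V T : finType) (e : rel V) S (L : bool -> V -> T) :
  ~ critical e S L.
Proof.
move=> crit.
have [t [x [y [z [[xS yS zS] [xy yz zx] [Ly Lz]]]]]] := critical_heavy crit.
(* Complements exactly when the heavy class is stable, so that it becomes a clique. *)
have crit' := critical_swap (~~ t) crit.
pose v i := nth x [:: x; y; z] i.
have vS i : i < 3 -> v i \in S by case: i => [|[|[|]]].
have v_inj i j : i < 3 -> j < 3 -> v i = v j -> i = j.
  have u3 : uniq [:: x; y; z] by rewrite /= !inE negb_or xy yz eq_sym zx.
  by move=> i3 j3 /eqP; rewrite /v nth_uniq // => /eqP.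
have Lv i : i < 3 -> L t (v i) = L t x by case: i => [|[|[|]]].
have lab_t u i : i < 3 -> label seed u i = if u then 0 else i.
  by case: u; case: i => [|[|[|]]].
have tt : true (+) ~~ t = t by case: (t).
apply: (seed_refuted crit' (v := v)).
  split=> // [u i j i3 j3|u i w _]; last by case: u.
  rewrite !lab_t //; case: u => [_|->//].
  by rewrite tt !Lv.
(* Two members of the heavy class in a common class of the other type would be both adjacent and
   non-adjacent. *)
move=> _ u i j i3 j3; rewrite !lab_t //; case: u => //.
have tf : false (+) ~~ t = ~~ t by [].
rewrite tf => Lij; apply: v_inj => //; apply/eqP; apply: contraT => ij.
have Lij' : L t (v i) = L t (v j) by rewrite !Lv.
have := crit_homog crit (vS _ i3) (vS _ j3) Lij ij.
by rewrite (crit_homog crit (vS _ i3) (vS _ j3) Lij' ij); case: (t).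
Qed.

(** Minimality makes the number of classes exactly |S| - 1: with more slack, deleting any vertex
    would leave a bad set. So with 9 or more vertices S would be [critical]. *)
Lemma bad_min_le8 (V : finType) (e : rel V) (S : {set V}) :
  symmetric e -> bad e S -> (forall R, bad e R -> #|S| <= #|R|) -> #|S| <= 8.
Proof.
move=> es [k [kc lt_k]] min_S; rewrite leqNgt; apply/negP => S9.
have [T [f [fh fk]]] := kc true; have [U [g [gh gk]]] := kc false.
(* [critical] wants one label type for both partitions, hence the sum type. *)
pose L t x : T + U := if t then inl (f x) else inr (g x).
have cL t : #|L t @: S| = if t then #|f @: S| else #|g @: S|.
  by case: t; rewrite /L imset_comp card_imset // => x y [].
have homL t : homog e t S (L t).
  by case: t => x y xS yS [fxy] xy; [apply: fh | apply: gh].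
apply: (@no_critical _ _ e S L); split=> //; rewrite !cL.
apply/eqP; rewrite eqn_leq; apply/andP; split; first lia.
rewrite leqNgt; apply/negP => lt_S.
have [x xS] : exists x, x \in S by apply/card_gt0P; lia.
have cSx := cardsD1 x S; rewrite xS in cSx.
suff /min_S : bad e (S :\ x) by lia.
exists (sel #|f @: S| #|g @: S|); split=> [t|/=]; last lia.
apply: coverable_sub (subD1set S x) (leqnn _) _.
by case: t; [exists T, f | exists U, g].
Qed.

(** * From bad sets to graphs *)

Section Transport.
Variables (U V : finType) (h : U -> V).
Hypothesis h_inj : injective h.
Variables (e' : rel U) (e : rel V).
Hypothesis he : forall x y, e (h x) (h y) = e' x y.

Lemma coverable_imset t (R : {set U}) k :
  coverable e' t R k <-> coverable e t (h @: R) k.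
Proof.
split=> [[T [f [fh fk]]]|[T [f [fh fk]]]].
  (* [None] colours the vertices outside the image of [h], where [f] offers no value. *)
  pose f' y := omap f [pick x | h x == y].
  have f'h x : f' (h x) = Some (f x).
    rewrite /f'; case: pickP => [z /eqP/h_inj->//|/(_ x)]; by rewrite eqxx.
  exists (option T), f'; split.
    move=> _ _ /imsetP[x xR ->] /imsetP[y yR ->]; rewrite !f'h he => -[fxy] hxy.
    by apply: fh => //; apply: contraNneq hxy => ->.
  rewrite -imset_comp (eq_imset (g := Some \o f)) => [|x]; last exact: f'h.
  by rewrite imset_comp card_imset // => x y [].
exists T, (f \o h); split; last by rewrite imset_comp.
move=> x y xR yR /= fxy xy; rewrite -he.
by apply: fh; rewrite ?imset_f // (inj_eq h_inj).
Qed.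

Lemma bad_imset (R : {set U}) : bad e' R <-> bad e (h @: R).
Proof.
by split=> -[k [kc lt_k]]; exists k; move: lt_k; rewrite card_imset // => lt_k;
  split=> // t; apply/coverable_imset.
Qed.

End Transport.

(** * Covers, chromatic number and clique cover number *)

Lemma coverable_eq_rel (V : finType) (e1 e2 : rel V) t1 t2 (S : {set V}) k :
  (forall x y, x != y -> e1 x y = t1 -> e2 x y = t2) ->
  coverable e1 t1 S k -> coverable e2 t2 S k.
Proof.
move=> e12 [T [f [fh fk]]]; exists T, f; split=> // x y xS yS fxy xy.
by apply: e12 => //; apply: fh.
Qed.

Lemma colorableP (G : sgraph) k :
  colorable G k <-> coverable (@adj G) false [set: G] k.
Proof.
split=> [/existsP[c /forallP cP]|[T [f [fh fk]]]].
  exists 'I_k, c; split; last by rewrite (leq_trans (max_card _)) ?card_ord.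
  move=> x y _ _ cxy _; apply/negP => /(implyP (forallP (cP x) y)).
  by rewrite cxy eqxx.
(* Colours are renumbered by their position in the image, since [T] may have more than [k]
   elements. *)
have lt_k x : index (f x) (enum (f @: [set: G])) < k.
  by apply: leq_trans fk; rewrite cardE index_mem mem_enum imset_f.
apply/existsP; exists [ffun x => Ordinal (lt_k x)].
apply/forallP => x; apply/forallP => y; apply/implyP => xy; rewrite !ffunE.
apply/eqP => -[/(congr1 (nth (f x) (enum (f @: [set: G]))))].
rewrite !nth_index ?mem_enum ?imset_f // => fxy.
suff : adj x y = false by rewrite xy.
by apply: fh; rewrite ?inE //; apply: contraTneq xy => ->; rewrite adj_irrefl.
Qed.

Lemma chi_leP (G : sgraph) k :
  chi G <= k <-> coverable (@adj G) false [set: G] k.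
Proof.
split=> [le_k|/colorableP]; rewrite /chi; last by case: ex_minnP => n _; apply.
move: le_k; rewrite /chi; case: ex_minnP => n /colorableP cn _ le_nk.
exact: coverable_sub le_nk cn.
Qed.

Lemma theta_leP (G : sgraph) k :
  theta G <= k <-> coverable (@adj G) true [set: G] k.
Proof.
have adjC (x y : G) : x != y -> @adj (compl G) x y = ~~ adj x y.
  by rewrite /= /compl_adj => ->.
split=> [/chi_leP|] c; [|apply/chi_leP]; apply: coverable_eq_rel c => x y xy.
  by rewrite adjC // => /negbFE.
by rewrite adjC // => ->.
Qed.

Lemma bad_setT (G : sgraph) :
  bad (@adj G) [set: G] <-> chi G + theta G < #|G|.
Proof.
rewrite -cardsT; split=> [[k [kc lt_k]]|lt_G].
  apply: leq_ltn_trans lt_k; rewrite addnC leq_add //.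
    exact/theta_leP.
  exact/chi_leP.
exists (sel (theta G) (chi G)); split; last by rewrite addnC.
by case; [apply/theta_leP | apply/chi_leP].
Qed.

Lemma bad_induced (G : sgraph) (S : {set G}) :
  bad (@adj G) S <-> chi (induced S) + theta (induced S) < #|induced S|.
Proof.
rewrite -bad_setT (@bad_imset _ _ val val_inj _ (@adj G)) //.
suff -> : val @: [set: induced S] = S by [].
apply/setP => x; apply/imsetP/idP => [[y _ ->]|xS]; first exact: valP.
by exists (exist _ x xS).
Qed.

Lemma bad_neq0 (V : finType) (e : rel V) (S : {set V}) : bad e S -> S != set0.
Proof. by case=> k [_]; rewrite -card_gt0; apply: leq_ltn_trans. Qed.

Lemma one_HNGP (G : sgraph) : one_HNG G <-> forall S, ~ bad (@adj G) S.
Proof.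
split=> [hng S bS|nbad S _].
  by have := hng S (bad_neq0 bS); rewrite leqNgt => /negP[]; apply/bad_induced.
by rewrite leqNgt; apply/negP => /bad_induced/nbad.
Qed.

(** With p cliques and q stable sets, a vertex is determined by its two classes, so p + q < |S| <=
    pq. Then (p - 1)(q - 1) > 1, which forces p + q >= 5. *)
Lemma bad_ge6 (V : finType) (e : rel V) (S : {set V}) : bad e S -> 6 <= #|S|.
Proof.
case=> k [kc lt_k]; have [T [f [fh fk]]] := kc true; have [U [g [gh gk]]] := kc false.
have : #|S| <= #|f @: S| * #|g @: S|.
  rewrite -cardsX -(@card_in_imset _ _ (fun x => (f x, g x))).
    by apply/subset_leq_card/subsetP => _ /imsetP[x xS ->]; rewrite inE /= !imset_f.
  move=> x y xS yS [fxy gxy]; apply/eqP; apply: contraT => xy.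
  by have := fh x y xS yS fxy xy; rewrite (gh x y xS yS gxy xy).
move=> /leq_trans/(_ (leq_mul fk gk)); move: lt_k {kc fk gk}.
(* The values 0 to 4 make the product linear; from 5 on the sum alone gives the bound. *)
by move: (k true) => [|[|[|[|[|p]]]]]; lia.
Qed.

Theorem theorem3p1 (G : sgraph) (G_nonempty : 0 < #|G|) :
  one_HNG G <-> ~ (exists H : sgraph, in_F H /\ contains_induced G H).
Proof.
split=> [/one_HNGP hng [H [[_ nH _] [S _ [f [f' fK f'K] fadj]]]]|noF].
  (* A bad set of H is pulled back along the isomorphism and then pushed into G. *)
  apply: nH; apply/one_HNGP => R bR.
  have bS : bad (@adj (induced S)) (f @^-1: R).
    apply/(bad_imset (can_inj fK) fadj).
    suff -> : f @: (f @^-1: R) = R by [].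
    apply/setP => x; apply/imsetP/idP => [[y] /[1!inE] yR ->//|xR].
    by exists (f' x); rewrite ?inE f'K.
  apply: (hng (val @: (f @^-1: R))).
  exact: (proj1 (bad_imset val_inj (e := @adj G) (fun _ _ => erefl) _) bS).
apply/one_HNGP => S bS; apply: noF.
(* A boolean form of [bad], so that a bad set of least size can be chosen. *)
pose badb (R : {set G}) := chi (induced R) + theta (induced R) < #|induced R|.
have badbP R : bad (@adj G) R <-> badb R by apply: bad_induced.
have [R /badbP bR min_R] := arg_minnP (fun R : {set G} => #|R|) (proj1 (badbP S) bS).
have {}min_R R' : bad (@adj G) R' -> #|R| <= #|R'| by move=> /badbP/min_R.
exists (induced R); split; last first.
  by exists R; [apply: bad_neq0 bR | exists id => //; exists id].
split.
- rewrite card_sig (eq_card (B := R)) //.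
  by rewrite (bad_ge6 bR) (bad_min_le8 (@adj_sym G) bR min_R).
- move/one_HNGP/(_ [set: induced R]); apply; apply/bad_setT.
  exact/bad_induced.
(* Two successive embeddings turn [Q] into a bad set of G with fewer vertices than [R]. *)
move=> R' _ R'lt; apply/one_HNGP => Q bQ.
have bQ' : bad (@adj (induced R)) (val @: Q).
  exact: (proj1 (bad_imset val_inj (e := @adj (induced R)) (fun _ _ => erefl) _) bQ).
have := min_R _ (proj1 (bad_imset val_inj (e := @adj G) (fun _ _ => erefl) _) bQ').
rewrite !card_imset; try exact: val_inj.
apply/negP; rewrite -ltnNge; apply: leq_ltn_trans (max_card _) _.
rewrite card_sig (eq_card (B := R')) //.
by move: (proper_card R'lt); rewrite cardsT card_sig (eq_card (B := R)).
Qed.
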